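(* Let $R(\frac zw)=P\circ\widehat R(\frac zw)$, where $\widehat R$ is the spectral parameter-dependent $R$-matrix given in the context and $P$ is the flip. Then $$R\Bigl(\frac zw\Bigr):V(z)\otimes V(w)\to V(w)\otimes V(z)$$ is an intertwining operator; specifically, $$R\Bigl(\frac zw\Bigr)(T_z\otimes T_w)(\Delta(x))=(T_w\otimes T_z)(\Delta(x))R\Bigl(\frac zw\Bigr),\qquad x\in U_{r,s}(\widehat{\mathfrak{so}_{2n+1}}),$$ where $T_z$ is the minimal affinization of the vector representation and $\Delta$ the coproduct, both given in the context.
   Context: Let $n\ge3$; $r,s$ algebraically independent, viewed in $\mathbb C$; $\mathbb K$ an extension of $\mathbb Q(r,s)$ containing $\sqrt r,\sqrt s$ (and $\sqrt{r+s}$); $z,w\in\mathbb C^\times$ (with $\frac zw$ not a pole of $\widehat R$). Put $r_i=r^2,s_i=s^2$ ($0\le i<n$), $r_n=r,s_n=s$. $U_{r,s}(\widehat{\mathfrak{so}_{2n+1}})$ is the unital associative algebra generated by $e_j,f_j,\omega_j^{\pm1},(\omega_j')^{\pm1}$ ($0\le j\le n$), $\gamma^{\pm1/2},(\gamma')^{\pm1/2}$, $D^{\pm1},(D')^{\pm1}$ with relations: $\gamma^{\pm1/2},(\gamma')^{\pm1/2}$ are central, $\gamma=(\omega_\delta')^{-1}$, $\gamma'=(\omega_\delta)^{-1}$, $\gamma\gamma'=(rs)^c$ ($c$ the canonical central element, $\delta=\alpha_0+\alpha_1+2\alpha_2+\cdots+2\alpha_n$ and $\omega_\delta,\omega'_\delta$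 the corresponding products); all $\omega_i^{\pm1},(\omega_j')^{\pm1},D^{\pm1},(D')^{\pm1}$ are invertible and commute with each other; $De_iD^{-1}=r_i^{\delta_{0i}}e_i$, $Df_iD^{-1}=r_i^{-\delta_{0i}}f_i$, $D'e_i(D')^{-1}=s_i^{\delta_{0i}}e_i$, $D'f_i(D')^{-1}=s_i^{-\delta_{0i}}f_i$; $\omega_je_i\omega_j^{-1}=\langle\omega_i',\omega_j\rangle e_i$, $\omega_jf_i\omega_j^{-1}=\langle\omega_i',\omega_j\rangle^{-1}f_i$, $\omega_j'e_i(\omega_j')^{-1}=\langle\omega_j',\omega_i\rangle^{-1}e_i$, $\omega_j'f_i(\omega_j')^{-1}=\langle\omega_j',\omega_i\rangle f_i$; $[e_i,f_j]=\frac{\delta_{ij}}{r_i-s_i}(\omega_i-\omega_i')$; and for $i\ne j$ the Serre relations $(\mathrm{ad}_le_i)^{1-a_{ij}}(e_j)=0=(\mathrm{ad}_rf_i)^{1-a_{ij}}(f_j)$, where $\mathrm{ad}_le_i(b)=e_ib-\omega_ib\omega_i^{-1}e_i$, $\mathrm{ad}_rf_i(b)=bf_i-f_i(\omega_i')^{-1}b\,\omega_i'$ and $(a_{ij})$ is the Cartan matrix of type $B_n^{(1)}$. Structure constants: for $1\le i,j\le n$, $\langle\omega_i',\omega_i\rangle=r^2s^{-2}$ ($i<n$), $\langle\omega_n',\omega_n\rangle=rs^{-1}$, $\langle\omega_i',\omega_{i+1}\rangle=r^{-2}$, $\langle\omega_{i+1}',\omega_i\rangle=s^2$, others $1$; and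 $\langle\omega_0',\omega_0\rangle=r^2s^{-2}$, $\langle\omega_0',\omega_1\rangle=r^{-2}s^{-2}$, $\langle\omega_0',\omega_2\rangle=r^{-2}$, $\langle\omega_0',\omega_n\rangle=r^2s^2$, $\langle\omega_1',\omega_0\rangle=r^2s^2$, $\langle\omega_2',\omega_0\rangle=s^2$, $\langle\omega_n',\omega_0\rangle=r^{-2}s^{-2}$, the remaining ones involving $0$ equal to $1$. Coproduct: $\Delta(e_i)=e_i\otimes1+\omega_i\otimes e_i$, $\Delta(f_i)=1\otimes f_i+f_i\otimes\omega_i'$, $\omega_i^{\pm1},(\omega_i')^{\pm1}$ group-like. $i'=2n+2-i$; $V=V(z)$ has basis $v_1,\dots,v_{2n+1}$; $E_{ij}v_j=v_i$; $P$ the flip. $T_z$: for $1\le i\le n-1$, $e_i\mapsto E_{i,i+1}-(rs)^{-1}E_{(i+1)',i'}$, $f_i\mapsto E_{i+1,i}-(rs)^{-1}E_{i',(i+1)'}$, $\omega_i\mapsto r^2E_{ii}+s^2E_{i+1,i+1}+s^{-2}E_{(i+1)',(i+1)'}+r^{-2}E_{i'i'}+\sum_{j\ne i,i+1,i',(i+1)'}E_{jj}$, $\omega_i'\mapsto$ the same with $r\leftrightarrow s$; $e_n\mapsto(r+s)^{1/2}((rs)^{-1/2}E_{n,n+1}-r^{-1}E_{n+1,n'})$, $f_n\mapsto(r+s)^{1/2}((rs)^{-1/2}E_{n+1,n}-s^{-1}E_{n',n+1})$, $\omega_n\mapsto rs^{-1}E_{nn}+E_{n+1,n+1}+r^{-1}sE_{n'n'}+(rs)^{-1}\sum_{j\le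 n-1}E_{jj}+rs\sum_{j\ge(n-1)'}E_{jj}$, $\omega_n'\mapsto r^{-1}sE_{nn}+E_{n+1,n+1}+rs^{-1}E_{n'n'}+(rs)^{-1}\sum_{j\le n-1}E_{jj}+rs\sum_{j\ge(n-1)'}E_{jj}$; $e_0\mapsto-r^{-1/2}s^{-3/2}z(E_{1'2}-rsE_{2'1})$, $f_0\mapsto-r^{-3/2}s^{-1/2}z^{-1}(E_{21'}-rsE_{12'})$, $\omega_0\mapsto s^2E_{11}+r^{-2}E_{22}+(rs)^{-2}\sum_{i=3}^nE_{ii}+E_{n+1,n+1}+s^{-2}E_{1'1'}+r^2E_{2'2'}+(rs)^2\sum_{j=n'}^{3'}E_{jj}$, $\omega_0'\mapsto$ the same with $r\leftrightarrow s$; $\gamma,\gamma'\mapsto1$; and $T_z(D)(z^kv)=r_0^kv$, $T_z(D')(z^kv)=s_0^kv$ for $k\in\mathbb Z$, $v\in V$. Spectral $R$-matrix: $\rho_i=\frac{2n+1}2-i$ for $i\le n$, $\rho_{n+1}=0$, $\rho_{i'}=-\rho_i$; $A=\{(i,j):1\le i<j\le n\}\cup\{(i,j):2\le i\le n,(i-1)'\le j\le1'\}$, $B=\{(i,j):1\le i\le n-1,n'\le j\le(i+1)'\}\cup\{(i,j):n'\le i<j\le1'\}$; $\widehat R(z)=\sum_{i\ne i'}E_{ii}\otimes E_{ii}+\frac{z-1}{r^2z-s^2}\{\sum_AE_{jj}\otimes E_{ii}+\sum_BE_{ii}\otimes E_{jj}+r^2s^2(\sum_AE_{ii}\otimes E_{jj}+\sum_BE_{jj}\otimes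 E_{ii})+rs\sum_{i\ne i'}(E_{n+1,n+1}\otimes E_{ii}+E_{ii}\otimes E_{n+1,n+1})\}+\frac{r^2-s^2}{r^2z-s^2}\{\sum_{i<j,i'\ne j}E_{ij}\otimes E_{ji}+z\sum_{i>j,i'\ne j}E_{ij}\otimes E_{ji}\}+\frac1{(z-(r^{-1}s)^{2n-1})(r^2z-s^2)}\sum_{i,j}d_{ij}(z)E_{i'j'}\otimes E_{ij}$, with $d_{ij}(z)=(s^2-r^2)z\{(z-1)(r^{-1}s)^{\rho_i-\rho_j}-\delta_{i,j'}[z-(r^{-1}s)^{2n-1}]\}$ if $i<j$; $(s^2-r^2)\{(z-1)(r^{-1}s)^{2n-1+\rho_i-\rho_j}-\delta_{i,j'}[z-(r^{-1}s)^{2n-1}]\}$ if $i>j$; $s^2(z-1)[z-(r^{-1}s)^{2n-3}]$ if $i=j\ne i'$; $rs(z-1)[z-(r^{-1}s)^{2n-1}]+(r^2-s^2)z[1-(r^{-1}s)^{2n-1}]$ if $i=j=i'$.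
   Formalization: The context's T_z(D)(z^k v)=r_0^k v defines no invertible operator; it is corrected to D(z^k v)=r_0^k z^k v (likewise D' with s_0), so V(z) is realized as V-valued functions of z in C^×, with the identity at every (z,w) where z/w is not a pole; D, D' and the square roots of γ, γ' are group-like. *)

(* Defs.v *)
From HB Require Import structures.
From mathcomp Require Import all_boot all_order all_algebra.
From mathcomp Require Import boolp functions reals complex mxtens.

Set Implicit Arguments.
Unset Strict Implicit.
Unset Printing Implicit Defensive.

Import Order.TTheory GRing.Theory Num.Theory.
Local Open Scope ring_scope.
Local Open Scope quotient_scope.

(* Associative unital K-algebras given by generators and relations. As 1 may   *)
(* be 0 in such an algebra, it is not an [algType] but only a [pzRingType] and *)
(* an [lmodType K] whose multiplication is K-bilinear.                         *)

Inductive term (K G : Type) : Type :=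
| Gen of G
| Scal of K
| Add of term K G & term K G
| Mul of term K G & term K G.
Arguments Gen {K G} g.
Arguments Scal {K G} k.

Declare Scope term_scope.
Delimit Scope term_scope with term.
Bind Scope term_scope with term.
Notation "1" := (Scal 1%R) : term_scope.
Notation "0" := (Scal 0%R) : term_scope.
Notation "x + y" := (Add x y) : term_scope.
Notation "x * y" := (Mul x y) : term_scope.
Notation "k *: x" := (Mul (Scal k) x) : term_scope.
Notation "x - y" := (Add x (Mul (Scal (- 1)%R) y)) : term_scope.

HB.instance Definition _ (K G : Type) := gen_eqMixin (term K G).
HB.instance Definition _ (K G : Type) := gen_choiceMixin (term K G).

Section Presentation.
Variables (K : fieldType) (G : Type).
Variable rel : term K G -> term K G -> Prop.

(* The least congruence containing [rel] whose quotient is a K-algebra.       *)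
Inductive cong : term K G -> term K G -> Prop :=
| cong_rel x y : rel x y -> cong x y
| cong_refl x : cong x x
| cong_sym x y : cong x y -> cong y x
| cong_trans y x z : cong x y -> cong y z -> cong x z
| cong_add x x' y y' : cong x x' -> cong y y' -> cong (x + y) (x' + y')
| cong_mul x x' y y' : cong x x' -> cong y y' -> cong (x * y) (x' * y')
| cong_addA x y z : cong (x + (y + z)) (x + y + z)
| cong_addC x y : cong (x + y) (y + x)
| cong_add0 x : cong (0 + x) x
| cong_addN x : cong (x - x) 0
| cong_mulA x y z : cong (x * (y * z)) (x * y * z)
| cong_mul1l x : cong (1 * x) x
| cong_mul1r x : cong (x * 1) x
| cong_mulDl x y z : cong ((x + y) * z) (x * z + y * z)
| cong_mulDr x y z : cong (x * (y + z)) (x * y + x * z)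
| cong_scalD a b : cong (Scal (a + b)) (Scal a + Scal b)
| cong_scalM a b : cong (Scal (a * b)) (Scal a * Scal b)
| cong_scalC a x : cong (Scal a * x) (x * Scal a).

Definition congb (x y : term K G) : bool := `[< cong x y >].

Lemma congb_equiv : equiv_class_of congb.
Proof.
split=> [x|x y|y x z].
- by apply/asboolP; apply: cong_refl.
- by apply/asboolP/asboolP; apply: cong_sym.
- by move=> /asboolP xy /asboolP yz; apply/asboolP; apply: cong_trans xy yz.
Qed.

Canonical congb_equiv_rel := EquivRelPack congb_equiv.

Definition presented : Type := {eq_quot congb}.
HB.instance Definition _ := Choice.on presented.
HB.instance Definition _ := EqQuotient.on presented.

Implicit Types x y z : presented.

Definition class (t : term K G) : presented := \pi_presented t.

Lemma classW (P : presented -> Prop) :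
  (forall t, P (class t)) -> forall x, P x.
Proof. by move=> Pt; elim/quotW. Qed.

Lemma eq_class (t u : term K G) : (class t = class u) <-> cong t u.
Proof.
split=> [/eqmodP /asboolP //|tu].
by apply/eqmodP/asboolP.
Qed.

Lemma cong_repr (t : term K G) : cong (repr (class t)) t.
Proof. by apply/eq_class; rewrite /class reprK. Qed.

Definition pres_add := lift_op2 presented (@Add K G).
Definition pres_mul := lift_op2 presented (@Mul K G).
Definition pres_scale (k : K) := lift_op1 presented (Mul (Scal k)).
Definition pres_opp := pres_scale (- 1).

Lemma pres_addE t u : pres_add (class t) (class u) = class (t + u).
Proof.
by unlock pres_add; apply/eq_class; apply: cong_add; apply: cong_repr.
Qed.

Lemma pres_mulE t u : pres_mul (class t) (class u) = class (t * u).
Proof.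
by unlock pres_mul; apply/eq_class; apply: cong_mul; apply: cong_repr.
Qed.

Lemma pres_scaleE k t : pres_scale k (class t) = class (k *: t).
Proof.
unlock pres_scale; apply/eq_class.
by apply: cong_mul; [apply: cong_refl | apply: cong_repr].
Qed.

Lemma pres_addA : associative pres_add.
Proof.
elim/classW=> x; elim/classW=> y; elim/classW=> z; rewrite !pres_addE.
by apply/eq_class; apply: cong_addA.
Qed.

Lemma pres_addC : commutative pres_add.
Proof.
elim/classW=> x; elim/classW=> y; rewrite !pres_addE.
by apply/eq_class; apply: cong_addC.
Qed.

Lemma pres_add0 : left_id (class 0) pres_add.
Proof.
by elim/classW=> x; rewrite pres_addE; apply/eq_class; apply: cong_add0.
Qed.

Lemma pres_addN : left_inverse (class 0) pres_opp pres_add.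
Proof.
elim/classW=> x; rewrite /pres_opp pres_scaleE pres_addE; apply/eq_class.
exact: cong_trans (cong_addC _ _) (cong_addN x).
Qed.

Lemma pres_mulA : associative pres_mul.
Proof.
elim/classW=> x; elim/classW=> y; elim/classW=> z; rewrite !pres_mulE.
by apply/eq_class; apply: cong_mulA.
Qed.

Lemma pres_mul1l : left_id (class 1) pres_mul.
Proof.
by elim/classW=> x; rewrite pres_mulE; apply/eq_class; apply: cong_mul1l.
Qed.

Lemma pres_mul1r : right_id (class 1) pres_mul.
Proof.
by elim/classW=> x; rewrite pres_mulE; apply/eq_class; apply: cong_mul1r.
Qed.

Lemma pres_mulDl : left_distributive pres_mul pres_add.
Proof.
elim/classW=> x; elim/classW=> y; elim/classW=> z.
rewrite !(pres_addE, pres_mulE); apply/eq_class.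
exact: cong_mulDl.
Qed.

Lemma pres_mulDr : right_distributive pres_mul pres_add.
Proof.
elim/classW=> x; elim/classW=> y; elim/classW=> z.
rewrite !(pres_addE, pres_mulE); apply/eq_class.
exact: cong_mulDr.
Qed.

HB.instance Definition _ := GRing.isPzRing.Build presented
  pres_addA pres_addC pres_add0 pres_addN
  pres_mulA pres_mul1l pres_mul1r pres_mulDl pres_mulDr.

Lemma classD t u : class (t + u) = class t + class u.
Proof. by rewrite [RHS]pres_addE. Qed.

Lemma classM t u : class (t * u) = class t * class u.
Proof. by rewrite [RHS]pres_mulE. Qed.

Lemma pres_scaleA a b x : pres_scale a (pres_scale b x) = pres_scale (a * b) x.
Proof.
elim/classW: x => x; rewrite !pres_scaleE; apply/eq_class.
apply: cong_trans (cong_mulA _ _ _) _; apply: cong_mul (cong_refl _).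
by apply: cong_sym; apply: cong_scalM.
Qed.

Lemma pres_scale1 : left_id 1 pres_scale.
Proof.
by elim/classW=> x; rewrite pres_scaleE; apply/eq_class; apply: cong_mul1l.
Qed.

Lemma pres_scaleDr : right_distributive pres_scale +%R.
Proof.
move=> k; elim/classW=> x; elim/classW=> y.
rewrite -classD !pres_scaleE -classD; apply/eq_class.
exact: cong_mulDr.
Qed.

Lemma pres_scaleDl x : {morph pres_scale^~ x : a b / a + b}.
Proof.
elim/classW: x => x a b /=; rewrite !pres_scaleE -classD; apply/eq_class.
apply: cong_trans (cong_mulDl _ _ _).
by apply: cong_mul (cong_refl _); apply: cong_scalD.
Qed.

HB.instance Definition _ := GRing.Zmodule_isLmodule.Build K presented
  pres_scaleA pres_scale1 pres_scaleDr pres_scaleDl.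

Lemma class0 : class 0 = 0. Proof. by []. Qed.

Lemma class1 : class 1 = 1. Proof. by []. Qed.

Lemma classZ k t : class (k *: t) = k *: class t.
Proof. by rewrite [RHS]pres_scaleE. Qed.

Lemma pres_scaleAl (k : K) x y : k *: (x * y) = (k *: x) * y.
Proof.
elim/classW: x => x; elim/classW: y => y.
rewrite -!(classM, classZ); apply/eq_class.
exact: cong_mulA.
Qed.

Lemma pres_scaleAr (k : K) x y : k *: (x * y) = x * (k *: y).
Proof.
elim/classW: x => x; elim/classW: y => y.
rewrite -!(classM, classZ); apply/eq_class.
apply: cong_trans (cong_mulA _ _ _) _.
apply: cong_trans (cong_sym (cong_mulA _ _ _)).
by apply: cong_mul (cong_refl _); apply: cong_scalC.
Qed.

Definition pgen (g : G) : presented := class (Gen g).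

End Presentation.

Definition alg_morphism (K : fieldType) (G H : Type)
    (relG : term K G -> term K G -> Prop) (relH : term K H -> term K H -> Prop)
    (f : presented relG -> presented relH) : Prop :=
  [/\ linear f, f 1 = 1 & {morph f : x y / x * y}].

(* The tensor product of algebras, presented by the elements x (x) 1 and      *)
(* 1 (x) y, which form commuting copies of A and B.                           *)
Section TensorProduct.
Variables (K : fieldType) (G H : Type).
Variables (relG : term K G -> term K G -> Prop).
Variables (relH : term K H -> term K H -> Prop).

Local Notation A := (presented relG).
Local Notation B := (presented relH).

Local Notation inL x := (@Gen K (A + B) (inl x)).
Local Notation inR y := (@Gen K (A + B) (inr y)).

Inductive tensor_rel : term K (A + B) -> term K (A + B) -> Prop :=
| tensor_1l : tensor_rel (inL 1%R) 1
| tensor_1r : tensor_rel (inR 1%R) 1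
| tensor_Dl x x' : tensor_rel (inL (x + x')) (inL x + inL x')
| tensor_Dr y y' : tensor_rel (inR (y + y')) (inR y + inR y')
| tensor_Zl k x : tensor_rel (inL (k *: x)) (k *: inL x)
| tensor_Zr k y : tensor_rel (inR (k *: y)) (k *: inR y)
| tensor_Ml x x' : tensor_rel (inL (x * x')) (inL x * inL x')
| tensor_Mr y y' : tensor_rel (inR (y * y')) (inR y * inR y')
| tensor_C x y : tensor_rel (inL x * inR y) (inR y * inL x).

Definition tens (x : A) (y : B) : presented tensor_rel :=
  pgen tensor_rel (inl x) * pgen tensor_rel (inr y).

End TensorProduct.

Notation tensor relG relH := (presented (@tensor_rel _ _ _ relG relH)).
Notation "x ⊗ y" := (tens x y) (at level 40, left associativity) : ring_scope.

(* The generators; a trailing V marks the inverse of an invertible generator, *)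
(* a prime is written [p]. [gen_g] is gamma^(1/2) and [gen_gp] is             *)
(* (gamma')^(1/2).                                                            *)
Inductive generator (n : nat) : Type :=
| gen_e of 'I_n.+1 | gen_f of 'I_n.+1
| gen_w of 'I_n.+1 | gen_wV of 'I_n.+1
| gen_wp of 'I_n.+1 | gen_wpV of 'I_n.+1
| gen_g | gen_gV | gen_gp | gen_gpV
| gen_D | gen_DV | gen_Dp | gen_DpV.
Arguments gen_g {n}. Arguments gen_gV {n}.
Arguments gen_gp {n}. Arguments gen_gpV {n}.
Arguments gen_D {n}. Arguments gen_DV {n}.
Arguments gen_Dp {n}. Arguments gen_DpV {n}.

(* Adjacency in the Dynkin diagram of type B_n^(1), n >= 3: the chain         *)
(* 1 - 2 - ... - n with the node 0 attached to 2.                             *)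
Definition adjacent (i j : nat) : bool :=
  [|| [&& (0 < i)%N, (0 < j)%N & (i == j.+1) || (j == i.+1)],
      (i == 0%N) && (j == 2%N) | (i == 2%N) && (j == 0%N)].

Definition cartan (n i j : nat) : int :=
  if i == j then 2 else
  if adjacent i j then (if i == n then - 2 else - 1) else 0.

Section QuantumAffine.
Variables (K : fieldType) (n : nat) (r s : K).

Definition r_ (i : nat) : K := if i == n then r else r ^+ 2.
Definition s_ (i : nat) : K := if i == n then s else s ^+ 2.

(* [pairing i j] is <omega'_i, omega_j>. *)
Definition pairing (i j : nat) : K :=
  match i, j with
  | 0, 0 => r ^+ 2 * s ^- 2
  | 0, _ => if j == 1%N then r ^- 2 * s ^- 2 else
            if j == 2%N then r ^- 2 else
            if j == n then r ^+ 2 * s ^+ 2 else 1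
  | _, 0 => if i == 1%N then r ^+ 2 * s ^+ 2 else
            if i == 2%N then s ^+ 2 else
            if i == n then r ^- 2 * s ^- 2 else 1
  | _, _ => if i == j then (if i == n then r * s^-1 else r ^+ 2 * s ^- 2) else
            if j == i.+1 then r ^- 2 else
            if i == j.+1 then s ^+ 2 else 1
  end.

Local Notation trm := (term K (generator n)).
Local Notation e i := (@Gen K _ (gen_e i)).
Local Notation f i := (@Gen K _ (gen_f i)).
Local Notation w i := (@Gen K _ (gen_w i)).
Local Notation wV i := (@Gen K _ (gen_wV i)).
Local Notation wp i := (@Gen K _ (gen_wp i)).
Local Notation wpV i := (@Gen K _ (gen_wpV i)).
Local Notation g := (@Gen K (generator n) gen_g).
Local Notation gV := (@Gen K (generator n) gen_gV).
Local Notation gp := (@Gen K (generator n) gen_gp).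
Local Notation gpV := (@Gen K (generator n) gen_gpV).
Local Notation D := (@Gen K (generator n) gen_D).
Local Notation DV := (@Gen K (generator n) gen_DV).
Local Notation Dp := (@Gen K (generator n) gen_Dp).
Local Notation DpV := (@Gen K (generator n) gen_DpV).

Definition ad_l (i : 'I_n.+1) (b : trm) : trm :=
  (e i * b - w i * b * wV i * e i)%term.
Definition ad_r (i : 'I_n.+1) (b : trm) : trm :=
  (b * f i - f i * wpV i * b * wp i)%term.

(* The product over alpha_0 + alpha_1 + 2 alpha_2 + ... + 2 alpha_n. *)
Definition prod_delta (x : 'I_n.+1 -> trm) : trm :=
  \big[@Mul K (generator n)/1%term]_(i < n.+1)
     (if (i < 2)%N then x i else x i * x i)%term.

(* The generators that are required to commute with each other. *)
Definition toral (x : generator n) : bool :=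
  match x with
  | gen_w _ | gen_wV _ | gen_wp _ | gen_wpV _
  | gen_D | gen_DV | gen_Dp | gen_DpV => true
  | _ => false
  end.

Definition gamma_half (x : generator n) : bool :=
  match x with
  | gen_g | gen_gV | gen_gp | gen_gpV => true
  | _ => false
  end.

(* The relation gamma gamma' = (rs)^c only introduces the notation (rs)^c. *)
Inductive affine_rel : trm -> trm -> Prop :=
| rel_wwV i : affine_rel (w i * wV i) 1
| rel_wVw i : affine_rel (wV i * w i) 1
| rel_wpwpV i : affine_rel (wp i * wpV i) 1
| rel_wpVwp i : affine_rel (wpV i * wp i) 1
| rel_ggV : affine_rel (g * gV) 1
| rel_gVg : affine_rel (gV * g) 1
| rel_gpgpV : affine_rel (gp * gpV) 1
| rel_gpVgp : affine_rel (gpV * gp) 1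
| rel_DDV : affine_rel (D * DV) 1
| rel_DVD : affine_rel (DV * D) 1
| rel_DpDpV : affine_rel (Dp * DpV) 1
| rel_DpVDp : affine_rel (DpV * Dp) 1
| rel_central x y : gamma_half x ->
    affine_rel (Gen x * Gen y) (Gen y * Gen x)
| rel_gamma : affine_rel (g * g * prod_delta (fun i => wp i)) 1
| rel_gammap : affine_rel (gp * gp * prod_delta (fun i => w i)) 1
| rel_toral x y : toral x -> toral y ->
    affine_rel (Gen x * Gen y) (Gen y * Gen x)
| rel_De (i : 'I_n.+1) : affine_rel (D * e i * DV) (r_ i ^+ (i == ord0) *: e i)
| rel_Df (i : 'I_n.+1) : affine_rel (D * f i * DV) (r_ i ^- (i == ord0) *: f i)
| rel_Dpe (i : 'I_n.+1) : affine_rel (Dp * e i * DpV) (s_ i ^+ (i == ord0) *: e i)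
| rel_Dpf (i : 'I_n.+1) : affine_rel (Dp * f i * DpV) (s_ i ^- (i == ord0) *: f i)
| rel_we (j i : 'I_n.+1) : affine_rel (w j * e i * wV j) (pairing i j *: e i)
| rel_wf (j i : 'I_n.+1) : affine_rel (w j * f i * wV j) ((pairing i j)^-1 *: f i)
| rel_wpe (j i : 'I_n.+1) : affine_rel (wp j * e i * wpV j) ((pairing j i)^-1 *: e i)
| rel_wpf (j i : 'I_n.+1) : affine_rel (wp j * f i * wpV j) (pairing j i *: f i)
| rel_ef (i j : 'I_n.+1) : affine_rel (e i * f j - f j * e i)
    (((i == j)%:R / (r_ i - s_ i)) *: (w i - wp i))
| rel_serre_e (i j : 'I_n.+1) : i != j ->
    affine_rel (iter `|1 - cartan n i j|%N (ad_l i) (e j)) 0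
| rel_serre_f (i j : 'I_n.+1) : i != j ->
    affine_rel (iter `|1 - cartan n i j|%N (ad_r i) (f j)) 0.

Local Notation U_affine := (presented affine_rel).

Definition ugen (x : generator n) : U_affine := pgen affine_rel x.

(* The coproduct on generators; those other than e_i and f_i are group-like. *)
Definition coproduct_gen (x : generator n) : tensor affine_rel affine_rel :=
  match x with
  | gen_e i => ugen (gen_e i) ⊗ 1 + ugen (gen_w i) ⊗ ugen (gen_e i)
  | gen_f i => 1 ⊗ ugen (gen_f i) + ugen (gen_f i) ⊗ ugen (gen_wp i)
  | _ => ugen x ⊗ ugen x
  end.

Definition is_coproduct (Delta : U_affine -> tensor affine_rel affine_rel) :=
  alg_morphism Delta /\ forall x, Delta (ugen x) = coproduct_gen x.

End QuantumAffine.

Notation U_affine n r s := (presented (@affine_rel _ n r s)).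
Notation U_affine2 n r s :=
  (tensor (@affine_rel _ n r s) (@affine_rel _ n r s)).

(* Indices i, j run over 1, ..., 2n+1 as in the mathematics; the underlying   *)
(* ordinals start at 0. [unit_mx n i j] is E_ij.                              *)
Section VectorRepresentation.
Variables (F : fieldType) (n : nat).

Definition dimV : nat := (2 * n).+1.
Definition prime_ix (i : nat) : nat := (2 * n + 2 - i)%N.

Definition unit_mx (i j : nat) : 'M[F]_dimV :=
  \matrix_(a, b) ((a.+1 == i) && (b.+1 == j))%:R.

Local Notation E := unit_mx.
Local Notation "i ^'" := (prime_ix i) : nat_scope.

(* [sr], [ss], [srs] are the square roots of r, s, r + s. *)
Variables (r s sr ss srs : F).

Definition mx_e (z : F) (i : nat) : 'M[F]_dimV :=
  if i == 0%N then
    (- (sr ^- 1 * ss ^- 3 * z)) *: (E 1^' 2 - (r * s) *: E 2^' 1)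
  else if i == n then
    srs *: ((sr * ss)^-1 *: E n n.+1 - r^-1 *: E n.+1 n^')
  else E i i.+1 - (r * s)^-1 *: E i.+1^' i^'.

Definition mx_f (z : F) (i : nat) : 'M[F]_dimV :=
  if i == 0%N then
    (- (sr ^- 3 * ss ^- 1 * z^-1)) *: (E 2 1^' - (r * s) *: E 1 2^')
  else if i == n then
    srs *: ((sr * ss)^-1 *: E n.+1 n - s^-1 *: E n^' n.+1)
  else E i.+1 i - (r * s)^-1 *: E i^' i.+1^'.

(* The image of omega_i, with r and s as arguments: for i < n, that of        *)
(* omega'_i is obtained by exchanging them.                                   *)
Definition mx_omega_swap (r s : F) (i : nat) : 'M[F]_dimV :=
  if i == 0%N then
    s ^+ 2 *: E 1 1 + r ^- 2 *: E 2 2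
    + (r * s) ^- 2 *: (\sum_(3 <= j < n.+1) E j j) + E n.+1 n.+1
    + s ^- 2 *: E 1^' 1^' + r ^+ 2 *: E 2^' 2^'
    + (r * s) ^+ 2 *: (\sum_(n^' <= j < 3^'.+1) E j j)
  else
    r ^+ 2 *: E i i + s ^+ 2 *: E i.+1 i.+1
    + s ^- 2 *: E i.+1^' i.+1^' + r ^- 2 *: E i^' i^'
    + \sum_(1 <= j < dimV.+1 | j \notin [:: i; i.+1; i^'; i.+1^']) E j j.

Definition mx_omega (i : nat) : 'M[F]_dimV :=
  if i == n then
    (r * s^-1) *: E n n + E n.+1 n.+1 + (r^-1 * s) *: E n^' n^'
    + (r * s)^-1 *: (\sum_(1 <= j < n) E j j)
    + (r * s) *: (\sum_(n.-1^' <= j < dimV.+1) E j j)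
  else mx_omega_swap r s i.

Definition mx_omegap (i : nat) : 'M[F]_dimV :=
  if i == n then
    (r^-1 * s) *: E n n + E n.+1 n.+1 + (r * s^-1) *: E n^' n^'
    + (r * s)^-1 *: (\sum_(1 <= j < n) E j j)
    + (r * s) *: (\sum_(n.-1^' <= j < dimV.+1) E j j)
  else mx_omega_swap s r i.

(* Twice rho_i, which is an integer. *)
Definition rho2 (i : nat) : int :=
  if (i <= n)%N then (2 * n + 1)%:Z - (2 * i)%:Z else
  if i == n.+1 then 0 else (2 * i^')%:Z - (2 * n + 1)%:Z.

(* (r^-1 s)^(m / 2) *)
Definition q_half (m : int) : F := (sr^-1 * ss) ^ m.

Definition set_A (i j : nat) : bool :=
  [&& 1 <= i, i < j & j <= n]%N
  || [&& 2 <= i, i <= n, i.-1^' <= j & j <= 1^']%N.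

Definition set_B (i j : nat) : bool :=
  [&& 1 <= i, i <= n.-1, n^' <= j & j <= i.+1^']%N
  || [&& n^' <= i, i < j & j <= 1^']%N.

Definition rden1 (u : F) : F := r ^+ 2 * u - s ^+ 2.
Definition rden2 (u : F) : F := u - (r^-1 * s) ^+ (2 * n - 1).

Definition d_coef (u : F) (i j : nat) : F :=
  if (i < j)%N then
    (s ^+ 2 - r ^+ 2) * u
    * ((u - 1) * q_half (rho2 i - rho2 j) - (i == j^')%:R * rden2 u)
  else if (j < i)%N then
    (s ^+ 2 - r ^+ 2)
    * ((u - 1) * q_half (2 * (2 * n - 1)%:Z + rho2 i - rho2 j)
       - (i == j^')%:R * rden2 u)
  else if i != i^' then
    s ^+ 2 * (u - 1) * (u - (r^-1 * s) ^+ (2 * n - 3))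
  else
    r * s * (u - 1) * rden2 u
    + (r ^+ 2 - s ^+ 2) * u * (1 - (r^-1 * s) ^+ (2 * n - 1)).

Definition R_hat (u : F) : 'M[F]_(dimV * dimV) :=
  \sum_(1 <= i < dimV.+1 | i != i^') (E i i *t E i i)
  + ((u - 1) / rden1 u) *:
    (\sum_(1 <= i < dimV.+1) \sum_(1 <= j < dimV.+1 | set_A i j)
        (E j j *t E i i)
     + \sum_(1 <= i < dimV.+1) \sum_(1 <= j < dimV.+1 | set_B i j)
        (E i i *t E j j)
     + (r ^+ 2 * s ^+ 2) *:
       (\sum_(1 <= i < dimV.+1) \sum_(1 <= j < dimV.+1 | set_A i j)
           (E i i *t E j j)
        + \sum_(1 <= i < dimV.+1) \sum_(1 <= j < dimV.+1 | set_B i j)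
           (E j j *t E i i))
     + (r * s) *:
       \sum_(1 <= i < dimV.+1 | i != i^')
         (E n.+1 n.+1 *t E i i + E i i *t E n.+1 n.+1))
  + ((r ^+ 2 - s ^+ 2) / rden1 u) *:
    (\sum_(1 <= i < dimV.+1)
        \sum_(1 <= j < dimV.+1 | (i < j)%N && (i^' != j)) (E i j *t E j i)
     + u *: \sum_(1 <= i < dimV.+1)
        \sum_(1 <= j < dimV.+1 | (j < i)%N && (i^' != j)) (E i j *t E j i))
  + (rden2 u * rden1 u)^-1 *:
    \sum_(1 <= i < dimV.+1) \sum_(1 <= j < dimV.+1)
      d_coef u i j *: (E i^' j^' *t E i j).

(* The poles of R_hat are exactly the zeros of its two denominators. *)
Definition not_pole (u : F) : Prop := rden1 u != 0 /\ rden2 u != 0.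

Definition flip_mx : 'M[F]_(dimV * dimV) :=
  \sum_(1 <= i < dimV.+1) \sum_(1 <= j < dimV.+1) (E i j *t E j i).

Definition R_mx (u : F) : 'M[F]_(dimV * dimV) := flip_mx *m R_hat u.

End VectorRepresentation.

(* The operators T_z(e_i), T_z(f_i), ... are matrices for each fixed z, but   *)
(* T_z(D) and T_z(D') rescale z: they send z^k v to (r_0 z)^k v and           *)
(* (s_0 z)^k v. So V(z) is realized as the space of V-valued functions of the *)
(* variable z in C^*, among which the z^k v, and V(z) (x) V(w) as the space   *)
(* of (V (x) V)-valued functions of (z, w).                                   *)
Section LoopSpace.
Variable C : fieldType.

Definition nonzero := {z : C | z != 0}.

(* c z, for c != 0 *)
Definition dilate (c : C) (z : nonzero) : nonzero := insubd z (c * val z).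

Variable n : nat.
Local Notation N := (dimV n).

Definition loop := nonzero -> 'cV[C]_N.
Definition loop2 := nonzero -> nonzero -> 'cV[C]_(N * N).
HB.instance Definition _ := GRing.Lmodule.on loop.
HB.instance Definition _ := GRing.Lmodule.on loop2.

(* [on_left a] and [on_right a] are a (x) id and id (x) a: the operator a     *)
(* acts on one leg of V (x) V and on the corresponding variable.              *)
Definition on_left (a : loop -> loop) (phi : loop2) : loop2 := fun z w =>
  \col_k
    a (fun z' => \col_i phi z' w (mxtens_index (i, (mxtens_unindex k).2)) 0)
      z (mxtens_unindex k).1 0.

Definition on_right (a : loop -> loop) (phi : loop2) : loop2 := fun z w =>
  \col_k
    a (fun w' => \col_j phi z w' (mxtens_index ((mxtens_unindex k).1, j)) 0)
      w (mxtens_unindex k).2 0.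

Variables (r s sr ss srs : C).

Definition T_gen (x : generator n) (phi : loop) : loop := fun z =>
  match x with
  | gen_e i => mx_e n r s sr ss srs (val z) i *m phi z
  | gen_f i => mx_f n r s sr ss srs (val z) i *m phi z
  | gen_w i => mx_omega n r s i *m phi z
  | gen_wV i => invmx (mx_omega n r s i) *m phi z
  | gen_wp i => mx_omegap n r s i *m phi z
  | gen_wpV i => invmx (mx_omegap n r s i) *m phi z
  | gen_g | gen_gV | gen_gp | gen_gpV => phi z
  | gen_D => phi (dilate (r_ n r 0) z)
  | gen_DV => phi (dilate (r_ n r 0)^-1 z)
  | gen_Dp => phi (dilate (s_ n s 0) z)
  | gen_DpV => phi (dilate (s_ n s 0)^-1 z)
  end.

(* R(z/w) : V(z) (x) V(w) -> V(w) (x) V(z) *)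
Definition R_op (phi : loop2) : loop2 := fun w z =>
  R_mx n r s sr ss (val z / val w) *m phi z w.

End LoopSpace.

(* A K-algebra acting by C-linear operators, K being viewed in C. *)
Definition is_representation (K C : fieldType) (iota : K -> C) (G : Type)
    (rel : term K G -> term K G -> Prop) (M : lmodType C)
    (T : presented rel -> M -> M) : Prop :=
  [/\ forall x, linear (T x),
      forall v, T 1 v = v,
      forall x y v, T (x * y) v = T x (T y v),
      forall x y v, T (x + y) v = T x v + T y v &
      forall k x v, T (k *: x) v = iota k *: T x v].

(* [T] is the family (T_z)_z, the minimal affinization. *)
Definition is_vector_rep (K C : fieldType) (iota : {rmorphism K -> C})
    (n : nat) (r s sr ss srs : K)
    (T : U_affine n r s -> loop C n -> loop C n) : Prop :=
  is_representation iota T /\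
  forall x phi, T (ugen r s x) phi =
    T_gen (iota r) (iota s) (iota sr) (iota ss) (iota srs) x phi.

(* [TT] is (T_z (x) T_w)_(z,w). *)
Definition is_tensor_rep (K C : fieldType) (iota : {rmorphism K -> C})
    (n : nat) (r s : K) (T : U_affine n r s -> loop C n -> loop C n)
    (TT : U_affine2 n r s -> loop2 C n -> loop2 C n) : Prop :=
  is_representation iota TT /\
  forall x y phi, TT (x ⊗ y) phi = on_left (T x) (on_right (T y) phi).

Definition alg_independent (K : fieldType) (x y : K) : Prop :=
  forall p : {poly {poly rat}},
    p != 0 -> (map_poly (map_poly (ratr : rat -> K)) p).[x, y] != 0.

(* Main.v *)
Require Import Defs.
From mathcomp Require Import all_boot all_order all_algebra.
From mathcomp Require Import reals complex mxtens zify ring.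

(* Every weight space of V (x) V other than the zero weight space is spanned  *)
(* by some v_a (x) v_b and v_b (x) v_a, so the R-matrix is given by scalars   *)
(* al, be on these and by a square matrix Z on the zero weight space, spanned *)
(* by the v_j' (x) v_j. Up to a scalar each T_z(e_i) is                       *)
(* c1 E_pq + c2 E_q'p' (p = i, q = i + 1 if i > 0; p = 1', q = 2 if i = 0),   *)
(* and the spectral parameter enters only through a factor t, equal to 1 if   *)
(* i > 0 and to u = z/w if i = 0. Comparing entries, the relation for e_i     *)
(* reduces to finitely many scalar identities, uniform in n, which are        *)
(* rational identities in r, s, u, q^(2n-1) and the q^(rho_j), q = s/r. The   *)
(* relation for f_i is the transpose of the one for e_i with r, s exchanged   *)
(* and u inverted, since these operations together fix the R-matrix.          *)
(* Finally, D and D' preserve z/w, so that the set of pairs (z, w) where the  *)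
(* R-matrix has no pole is stable, and the relation extends from generators   *)
(* to the algebra.                                                            *)

Set Implicit Arguments.
Unset Strict Implicit.
Unset Printing Implicit Defensive.

Import Order.TTheory GRing.Theory Num.Theory.
Local Open Scope ring_scope.

(** Since R = P R^ and P exchanges the tensor factors ([flip_tens]), the claim is that R^(u), u =
    z/w, carries the coproduct to the opposite coproduct. R^ preserves weights, and [R_hatE] puts
    its entries in the shape [ice]; hence it commutes with omega_i (x) omega_i ([R_hat_diag]).

    For e_i, [ice_intertwine] reduces the relation at every entry to the scalar identities collected
    in [ice_local]. They are verified for the three kinds of nodes in [mid_local], [last_local] and
    [zero_local]. With q = s/r, the powers q^(rho_j) enter as variables, subject only to rho_(i+1) =
    rho_i - 1 below n, rho_i' = - rho_i, rho_n = 1/2, rho_(n+1) = 0 and, at the affine node, 2 rho_1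
    = 2n - 1. The symmetry [R_hat_sym] turns the relation [R_hat_e] into [R_hat_f].

    [R_mx_coproduct] states the result for the matrices attached to the generators. D and D' act by
    substitutions that keep z/w ([gen_shift_ratio]), so [intertwine_all] can pass to sums and
    products by induction, staying away from the poles. *)

(** * Tactics for index arithmetic and scalar identities *)

Ltac clear_ring :=
  repeat match goal with
  | H : context [@GRing.zero] |- _ => clear H
  | H : context [@GRing.exp] |- _ => clear H
  end.
(** Hypotheses about ring elements are dropped, so that [lia] sees only the arithmetic of
    indices. *)
Ltac nlia := solve [ clear_ring; try subst; unfold dimV, prime_ix in *; lia ].
Ltac cases_if :=
  repeat match goal with
  | |- context [if ?b then _ else _] =>
      first [ have -> : b = false by nlia
            | have -> : b = true by nlia
            | case: (boolP b) => ? ]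
  end.
(** Lets [ring] deduce an equation from another one when the differences of their two sides
    coincide. *)
Lemma eq_by_sub (V : zmodType) (x y x' y' : V) : x' = y' -> x - y = x' - y' -> x = y.
Proof. by move=> ->; rewrite subrr => /eqP; rewrite subr_eq0 => /eqP. Qed.
Ltac linear_from H := apply: (eq_by_sub H); ring.

(** If q is the middle index n + 1, then q' = q, and the identity [R] matches the goal only after
    this rewriting. *)
Ltac linear_from_mid R := first [ linear_from R |
  match goal with H : is_true (prime_ix _ ?q == ?q) |- _ =>
    move: R; rewrite (eqP H) => R; linear_from R end ].

(** * Intertwining for matrices of the shape [ice], reduced to scalar identities *)

Section EightTerm.
Variables (F : comPzRingType) (n : nat).
Local Notation "i ^'" := (prime_ix n i) : nat_scope.

Local Notation in_range i := (is_true (0 < i <= dimV n)%N).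

(* The matrix coefficient at v_a (x) v_b of the image of v_c (x) v_d. *)
Definition ice (al be Z : nat -> nat -> F) (a b c d : nat) : F :=
  if d == c^' then (if b == a^' then Z b d else 0)
  else if (a == c) && (b == d) then (if a == b then 1 else al a b)
  else if (a == d) && (b == c) then be a b else 0.

Variables (al be Z : nat -> nat -> F) (om : nat -> F).
Variables (p q : nat) (c1 c2 t : F).
Hypotheses (p_in : in_range p) (q_in : in_range q).
Hypotheses (ppN : p <> p^') (pqN : p <> q) (pqpN : p <> q^').

(* [d] far from the indices moved by the root vector; then the pairs of moved *)
(* indices; then the two rows of weight alpha and two columns of weight       *)
(* - alpha of the zero weight block.                                          *)
Record ice_local : Prop := IceLocal {
  ice_far d : in_range d -> [&& d != p, d != q, d != p^' & d != q^'] ->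
    [/\ al p d = om d * al q d, al d q = om d * al d p,
        al q^' d = om d * al p^' d & al d p^' = om d * al d q^'] /\
    [/\ be d q = t * be d p, be d p^' = t * be d q^',
        be p d = t * be q d & be q^' d = t * be p^' d];
  ice_pp : t = t * om p * al q p + be p q /\ om p = al p q + t * om p * be q p;
  ice_qq : q != (q^')%N -> t = t * om q^' * al p^' q^' + be q^' p^' /\
      om q^' = al q^' p^' + t * om q^' * be p^' q^';
  ice_from_qq : q != (q^')%N -> t * al p q + om q * be p q = t * om q /\
      t * be q p + om q * al q p = 1;
  ice_from_pp : t * al q^' p^' + om p^' * be q^' p^' = t * om p^' /\
      t * be p^' q^' + om p^' * al p^' q^' = 1;
  ice_row1 c : in_range c ->
    (if c == q then t * c1 * al p q^' else 0)
    + (if c == p^' then t * c2 * be p q^' else 0)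
    + om c * ((if c == q^' then c1 * be p q^' else 0)
              + (if c == p then c2 * al p q^' else 0))
    = c2 * Z p^' c^' + t * om q^' * (c1 * Z q^' c^');
  ice_row2 c : in_range c ->
    (if c == q then t * c1 * be q^' p else 0)
    + (if c == p^' then t * c2 * al q^' p else 0)
    + om c * ((if c == q^' then c1 * al q^' p else 0)
              + (if c == p then c2 * be q^' p else 0))
    = c1 * Z q c^' + t * om p * (c2 * Z p c^');
  ice_col1 b : in_range b ->
    t * (c2 * Z b q) + om p^' * (c1 * Z b p)
    = (if b == p then c1 * al p^' q else 0)
      + (if b == q^' then c2 * be q p^' else 0)
      + t * om b * ((if b == p^' then c1 * be q p^' else 0)
                    + (if b == q then c2 * al p^' q else 0));
  ice_col2 b : in_range b ->
    t * (c1 * Z b p^') + om q * (c2 * Z b q^')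
    = (if b == p then c1 * be p^' q else 0)
      + (if b == q^' then c2 * al q p^' else 0)
      + t * om b * ((if b == p^' then c1 * al q p^' else 0)
                    + (if b == q then c2 * be p^' q else 0)) }.

Hypothesis loc : ice_local.

Local Notation Rc := (ice al be Z).
Lemma ice0 a b c d : ~~ ((d == c^') && (b == a^'))%N -> ~~ ((a == c) && (b == d)) ->
  ~~ ((a == d) && (b == c)) -> Rc a b c d = 0.
Proof.
move=> N1 /negPf N2 /negPf N3; rewrite /ice N2 N3; move: N1.
by case: eqP => //= _ /negPf ->.
Qed.

Lemma primeK i : in_range i -> (i^'^')%N = i.
Proof. rewrite /prime_ix /dimV; lia. Qed.

(** The indices q and q' are not compared: they coincide at the last node, where q = n + 1. *)
Lemma pq_neqE :
  ((p == q) = false) * ((q == p) = false)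
  * ((p == p^')%N = false) * ((p^' == p)%N = false)
  * ((p == q^')%N = false) * ((q^' == p)%N = false)
  * ((q == p^')%N = false) * ((p^' == q)%N = false)
  * ((q^' == p^')%N = false) * ((p^' == q^')%N = false).
Proof. by do 9?split; apply/negbTE; nlia. Qed.

Lemma if_natr (P : bool) (x : F) : (if P then x else 0) = P%:R * x.
Proof. by case: P; rewrite ?mul1r ?mul0r. Qed.

(** Kronecker deltas replace the nested conditionals, so that [ring] can compare entries of such a
    column. *)
Lemma iceN a b c d : c == d = false -> d == (c^')%N = false ->
  Rc a b c d = (a == c)%:R * (b == d)%:R * al c d
               + (a == d)%:R * (b == c)%:R * be d c.
Proof.
move=> cdN dcN; rewrite /ice dcN.
have dcE : (d == c) = false by rewrite eq_sym.
have [->|acN] := eqVneq a c; first rewrite cdN.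
  by have [->|bdN] := eqVneq b d; rewrite ?cdN ?dcE /=; ring.
have [->|adN] := eqVneq a d => /=; last by ring.
by have [->|bcN] := eqVneq b c => /=; ring.
Qed.

Lemma ice1 a b c : c == (c^')%N = false ->
  Rc a b c c = (a == c)%:R * (b == c)%:R.
Proof.
move=> cN; rewrite /ice cN.
have [->|acN] := eqVneq a c => /=; last by ring.
by have [bc|bcN] := eqVneq b c; rewrite ?eqxx /=; ring.
Qed.

(** The root vector sends the zero weight space to the weight space of its root, spanned by v_p (x)
    v_q' and v_q' (x) v_p. Only these two rows are nontrivial; they are [ice_row1] and
    [ice_row2]. *)
Lemma ice_zero_column a b c :
  in_range a -> in_range b -> in_range c -> let d := (c^')%N in
  t * ((if c == q then c1 * Rc a b p d else 0)
       + (if c == p^' then c2 * Rc a b q^' d else 0))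
  + om c * ((if d == q then c1 * Rc a b c p else 0)
            + (if d == p^' then c2 * Rc a b c q^' else 0))
  = (if b == p then c1 * Rc a q c d else 0)
    + (if b == q^' then c2 * Rc a p^' c d else 0)
    + t * om b * ((if a == p then c1 * Rc q b c d else 0)
                  + (if a == q^' then c2 * Rc p^' b c d else 0)).
Proof.
move=> a_in b_in c_in d.
have R1 := ice_row1 loc c_in. have R2 := ice_row2 loc c_in.
have [/andP[/eqP ap /eqP bq]|N1] := boolP ((a == p) && (b == q^'))%N.
  move: R1; clear R2; rewrite /ice /d ap bq.
  cases_if; move=> R1; linear_from R1.
have [/andP[/eqP ap /eqP bq]|N2] := boolP ((a == q^') && (b == p))%N.
  move: R2; clear R1; rewrite /ice /d ap bq.
  cases_if; move=> R1; linear_from R1.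
clear R1 R2; rewrite /d.
have zero (P : bool) (x : F) : (P -> x = 0) -> (if P then x else 0) = 0.
  by case: P => // ->.
(rewrite !zero; [by rewrite /ice; cases_if; ring | by move=> ?; rewrite ice0 ?mulr0 //; nlia ..]).
Qed.

(** These two columns have the weight opposite to the root, so their images lie in the zero weight
    space. Only the rows v_b' (x) v_b count, and there the identity is [ice_col1] or [ice_col2]; the
    four moved indices are the special values of b. *)
Lemma ice_root_column a b c d : in_range a -> in_range b -> in_range c -> in_range d ->
  (c == p^') && (d == q) || (c == q) && (d == p^') ->
  t * ((if c == q then c1 * Rc a b p d else 0)
       + (if c == p^' then c2 * Rc a b q^' d else 0))
  + om c * ((if d == q then c1 * Rc a b c p else 0)
            + (if d == p^' then c2 * Rc a b c q^' else 0))
  = (if b == p then c1 * Rc a q c d else 0)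
    + (if b == q^' then c2 * Rc a p^' c d else 0)
    + t * om b * ((if a == p then c1 * Rc q b c d else 0)
                  + (if a == q^' then c2 * Rc p^' b c d else 0)).
Proof.
move=> a_in b_in c_in d_in cd.
have R1 := ice_col1 loc b_in. have R2 := ice_col2 loc b_in.
have [/eqP ab|N1] := boolP (b == a^')%N; last first.
  clear R1 R2.
  have zero (P : bool) (x : F) : (P -> x = 0) -> (if P then x else 0) = 0.
    by case: P => // ->.
  (rewrite !zero; [by rewrite /ice; cases_if; ring | by move=> ?; rewrite ice0 ?mulr0 //; nlia ..]).
have {}ab : (a = b^')%N by nlia.
case/orP: cd => /andP[/eqP cp /eqP dq].
  move: R1; clear R2; rewrite cp dq; clear c d c_in d_in cp dq.
  have [bx|?] := eqVneq b (p)%N.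
    have ax : (a = p^')%N by nlia.
    clear ab; rewrite ax bx /ice; cases_if; move=> R; linear_from_mid R.
  have [bx|?] := eqVneq b (q^')%N.
    have ax : (a = q)%N by nlia.
    clear ab; rewrite ax bx /ice; cases_if; move=> R; linear_from_mid R.
  have [bx|?] := eqVneq b (p^')%N.
    have ax : (a = p)%N by nlia.
    clear ab; rewrite ax bx /ice; cases_if; move=> R; linear_from_mid R.
  have [bx|?] := eqVneq b (q)%N.
    have ax : (a = q^')%N by nlia.
    clear ab; rewrite ax bx /ice; cases_if; move=> R; linear_from_mid R.
  rewrite ab /ice; cases_if; move=> R; linear_from_mid R.
move: R2; clear R1; rewrite cp dq; clear c d c_in d_in cp dq.
have [bx|?] := eqVneq b (p)%N.
  have ax : (a = p^')%N by nlia.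
  clear ab; rewrite ax bx /ice; cases_if; move=> R; linear_from_mid R.
have [bx|?] := eqVneq b (q^')%N.
  have ax : (a = q)%N by nlia.
  clear ab; rewrite ax bx /ice; cases_if; move=> R; linear_from_mid R.
have [bx|?] := eqVneq b (p^')%N.
  have ax : (a = p)%N by nlia.
  clear ab; rewrite ax bx /ice; cases_if; move=> R; linear_from_mid R.
have [bx|?] := eqVneq b (q)%N.
  have ax : (a = q^')%N by nlia.
  clear ab; rewrite ax bx /ice; cases_if; move=> R; linear_from_mid R.
rewrite ab /ice; cases_if; move=> R; linear_from_mid R.
Qed.

(** No zero weight space is met here, so R involves only v_c (x) v_d, v_d (x) v_c and their images.
    Both sides vanish if neither c nor d is q or p', that is, if the root vector kills v_c and v_d.
    Otherwise [ice_far] applies if one of c, d is outside p, q, p', q', and the identities for pairs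
    of moved indices apply if both are inside. *)
Lemma ice_generic_column a b c d : in_range a -> in_range b -> in_range c -> in_range d ->
  d <> (c^')%N -> ~~ ((c == p^') && (d == q) || (c == q) && (d == p^')) ->
  t * ((if c == q then c1 * Rc a b p d else 0)
       + (if c == p^' then c2 * Rc a b q^' d else 0))
  + om c * ((if d == q then c1 * Rc a b c p else 0)
            + (if d == p^' then c2 * Rc a b c q^' else 0))
  = (if b == p then c1 * Rc a q c d else 0)
    + (if b == q^' then c2 * Rc a p^' c d else 0)
    + t * om b * ((if a == p then c1 * Rc q b c d else 0)
                  + (if a == q^' then c2 * Rc p^' b c d else 0)).
Proof.
move=> a_in b_in c_in d_in dc cd.
rewrite !if_natr.
have bf := (pq_neqE, eqxx).
have [pK qK] := (primeK p_in, primeK q_in).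
have [/andP[/andP[/negPf f1 /negPf f2] /andP[/negPf f3 /negPf f4]]|N] :=
  boolP ([&& c != q & c != p^'] && [&& d != q & d != p^'])%N.
  have [e1 e2] : (q == c = false) /\ (p^' == c = false)%N by rewrite ![_ == c]eq_sym.
  have [e3 e4] : (q == d = false) /\ (p^' == d = false)%N by rewrite ![_ == d]eq_sym.
  have dcF : (d == c^')%N = false by apply/eqP.
  have x1 : Rc a q c d = 0 by rewrite ice0 ?dcF ?e1 ?e3 ?andbF.
  have x2 : Rc a p^' c d = 0 by rewrite ice0 ?dcF ?e2 ?e4 ?andbF.
  have x3 : Rc q b c d = 0 by rewrite ice0 ?dcF ?e1 ?e3.
  have x4 : Rc p^' b c d = 0 by rewrite ice0 ?dcF ?e2 ?e4.
  by rewrite f1 f2 f3 f4 x1 x2 x3 x4 /=; ring.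
have [Fc|Nc] := boolP [&& c != p, c != q, c != p^' & c != q^']%N.
  have [[a1 a2 a3 a4] [b1 b2 b3 b4]] := ice_far loc c_in Fc.
  case/and4P: Fc => /negPf f1 /negPf f2 /negPf f3 /negPf f4.
  have e1 := f1; have e2 := f2; have e3 := f3; have e4 := f4.
  rewrite eq_sym in e1; rewrite eq_sym in e2; rewrite eq_sym in e3; rewrite eq_sym in e4.
  have g1 : (p == c^')%N = false by clear -f3 c_in p_in; nlia.
  have g2 : (q == c^')%N = false by clear -f4 c_in q_in; nlia.
  have g3 : (p^' == c^')%N = false by clear -f1 c_in p_in; nlia.
  have g4 : (q^' == c^')%N = false by clear -f2 c_in q_in; nlia.
  have cf := (f1, f2, f3, f4, e1, e2, e3, e4, g1, g2, g3, g4, bf).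
  have [oq|oN0] := eqVneq d (q)%N.
    rewrite oq !cf /= ?mulr0n ?mul0r ?add0r ?addr0 !iceN ?pK ?qK ?cf //.
    by have [->|?] := eqVneq b c; rewrite ?cf ?(a2, b3) /=; ring.
  have [oq|oN1] := eqVneq d (p^')%N.
    rewrite oq !cf /= ?mulr0n ?mul0r ?add0r ?addr0 !iceN ?pK ?qK ?cf //.
    by have [->|?] := eqVneq b c; rewrite ?cf ?(a4, b4) /=; ring.
  by move: N; rewrite !(cf, oN0, oN1).
have [Fd|Nd] := boolP [&& d != p, d != q, d != p^' & d != q^']%N.
  have [[a1 a2 a3 a4] [b1 b2 b3 b4]] := ice_far loc d_in Fd.
  case/and4P: Fd => /negPf f1 /negPf f2 /negPf f3 /negPf f4.
  have e1 := f1; have e2 := f2; have e3 := f3; have e4 := f4.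
  rewrite eq_sym in e1; rewrite eq_sym in e2; rewrite eq_sym in e3; rewrite eq_sym in e4.
  have g1 : (p == d^')%N = false by clear -f3 d_in p_in; nlia.
  have g2 : (q == d^')%N = false by clear -f4 d_in q_in; nlia.
  have g3 : (p^' == d^')%N = false by clear -f1 d_in p_in; nlia.
  have g4 : (q^' == d^')%N = false by clear -f2 d_in q_in; nlia.
  have cf := (f1, f2, f3, f4, e1, e2, e3, e4, g1, g2, g3, g4, bf).
  have [oq|oN0] := eqVneq c (q)%N.
    rewrite oq !cf /= ?mulr0n ?mul0r ?add0r ?addr0 !iceN ?pK ?qK ?cf //.
    by have [->|?] := eqVneq b d; rewrite ?cf ?(a1, b1) /=; ring.
  have [oq|oN1] := eqVneq c (p^')%N.
    rewrite oq !cf /= ?mulr0n ?mul0r ?add0r ?addr0 !iceN ?pK ?qK ?cf //.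
    by have [->|?] := eqVneq b d; rewrite ?cf ?(a3, b2) /=; ring.
  by move: N; rewrite !(cf, oN0, oN1).
(* The fourth alternative excludes q' = q, which keeps the cases disjoint at the last node. *)
have four x : ~~ [&& x != p, x != q, x != p^' & x != q^']%N ->
    [\/ x = p, x = q, x = p^' | x = q^' /\ (q^' == q) = false]%N.
  rewrite !negb_and !negbK; case/or4P=> /eqP ->;
    [by constructor 1 | by constructor 2 | by constructor 3 |].
  by case: (eqVneq (q^')%N q) => [->|_]; [constructor 2 | constructor 4].
(* Ten of the sixteen pairs contradict [N], [dc] or [cd]. In each of the other six, fixing b leaves
   one scalar identity times a Kronecker delta in a. *)
case/four: Nc => [cx|cx|cx|[cx qqF']]; case/four: Nd => [dx|dx|dx|[dx qqF'']];
  rewrite {}cx {}dx in c_in d_in dc cd N *.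
- by move: N; rewrite !bf.
- have [E1 E2] := ice_pp loc.
  rewrite ?bf /= ?mulr0n ?mul0r ?add0r ?addr0 ?ice1 ?iceN ?pK ?qK ?bf //.
  have [->|?] := eqVneq b (p)%N.
    by rewrite ?bf /=; linear_from (congr1 (fun x => x * (c1 * (a == p%N)%:R)) E2).
  by rewrite /=; ring.
- by move: dc; rewrite ?pK ?qK.
- by move: N; rewrite !bf ?qqF''.
- have [E1 E2] := ice_pp loc.
  rewrite ?bf /= ?mulr0n ?mul0r ?add0r ?addr0 ?ice1 ?iceN ?pK ?qK ?bf //.
  have [->|?] := eqVneq b (p)%N.
    by rewrite ?bf /=; linear_from (congr1 (fun x => x * (c1 * (a == p%N)%:R)) E1).
  by rewrite /=; ring.
- have qqF : (q == q^')%N = false by apply/eqP.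
  have {}qqF' : (q^' == q)%N = false by rewrite eq_sym.
  have [|E1 E2] := ice_from_qq loc; first by rewrite qqF.
  rewrite ?(qqF, qqF', bf) /= ?mulr0n ?mul0r ?add0r ?addr0 ?ice1 ?iceN ?pK ?qK ?(qqF, qqF', bf) //.
  have [->|?] := eqVneq b (q)%N.
    by rewrite ?(qqF, qqF', bf) /=; linear_from (congr1 (fun x => x * (c1 * (a == p%N)%:R)) E1).
  have [->|?] := eqVneq b (p)%N.
    by rewrite ?(qqF, qqF', bf) /=; linear_from (congr1 (fun x => x * (c1 * (a == q%N)%:R)) E2).
  by rewrite /=; ring.
- by move: cd; rewrite !eqxx ?orbT.
- by move: dc; rewrite ?pK ?qK.
- by move: dc; rewrite ?pK ?qK.
- by move: cd; rewrite !eqxx ?orbT.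
- have [E1 E2] := ice_from_pp loc.
  rewrite ?bf /= ?mulr0n ?mul0r ?add0r ?addr0 ?ice1 ?iceN ?pK ?qK ?bf //.
  have [->|?] := eqVneq b (p^')%N.
    by rewrite ?bf /=; linear_from (congr1 (fun x => x * (c2 * (a == q^'%N)%:R)) E1).
  have [->|?] := eqVneq b (q^')%N.
    by rewrite ?bf /=; linear_from (congr1 (fun x => x * (c2 * (a == p^'%N)%:R)) E2).
  by rewrite /=; ring.
- have qqF : (q == q^')%N = false by rewrite eq_sym.
  have {}qqF' : (q^' == q)%N = false by rewrite eq_sym.
  have [|E1 E2] := ice_qq loc; first by rewrite qqF.
  rewrite ?(qqF, qqF', bf) /= ?mulr0n ?mul0r ?add0r ?addr0 ?ice1 ?iceN ?pK ?qK ?(qqF, qqF', bf) //.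
  have [->|?] := eqVneq b (q^')%N.
    by rewrite ?(qqF, qqF', bf) /=; linear_from (congr1 (fun x => x * (c2 * (a == q^'%N)%:R)) E1).
  by rewrite /=; ring.
- by move: N; rewrite !bf ?qqF'.
- by move: dc; rewrite ?pK ?qK.
- have qqF : (q == q^')%N = false by rewrite eq_sym.
  have {}qqF' : (q^' == q)%N = false by rewrite eq_sym.
  have [|E1 E2] := ice_qq loc; first by rewrite qqF.
  rewrite ?(qqF, qqF', bf) /= ?mulr0n ?mul0r ?add0r ?addr0 ?ice1 ?iceN ?pK ?qK ?(qqF, qqF', bf) //.
  have [->|?] := eqVneq b (q^')%N.
    by rewrite ?(qqF, qqF', bf) /=; linear_from (congr1 (fun x => x * (c2 * (a == q^'%N)%:R)) E2).
  by rewrite /=; ring.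
- by move: N; rewrite !bf ?qqF'.
Qed.

(* The entry at (ab, cd) of [R (t e (x) 1 + om (x) e) = (1 (x) e + t e (x) om) R] *)
(* for [e = c1 E_pq + c2 E_q'p'].                                             *)
Lemma ice_intertwine a b c d :
  in_range a -> in_range b -> in_range c -> in_range d ->
  t * ((if c == q then c1 * Rc a b p d else 0)
       + (if c == p^' then c2 * Rc a b q^' d else 0))
  + om c * ((if d == q then c1 * Rc a b c p else 0)
            + (if d == p^' then c2 * Rc a b c q^' else 0))
  = (if b == p then c1 * Rc a q c d else 0)
    + (if b == q^' then c2 * Rc a p^' c d else 0)
    + t * om b * ((if a == p then c1 * Rc q b c d else 0)
                  + (if a == q^' then c2 * Rc p^' b c d else 0)).
Proof.
move=> a_in b_in c_in d_in.
have [->|dc] := eqVneq d (c^')%N; first exact: ice_zero_column.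
have [cd|cd] := boolP ((c == p^') && (d == q) || (c == q) && (d == p^'))%N.
  exact: ice_root_column.
by apply: ice_generic_column => //; apply/eqP.
Qed.

End EightTerm.

(** * The coefficients of the R-matrix and the powers of q = s/r *)

Lemma sqrt_neq0 (F : fieldType) (a b : F) : b != 0 -> a = b ^+ 2 -> a != 0.
Proof. by move=> b0 ->; rewrite expf_neq0. Qed.

Section Coefficients.
Variables (F : fieldType) (n : nat) (r s sr ss u : F).
Local Notation "i ^'" := (prime_ix n i) : nat_scope.
Local Notation in_range i := (is_true (0 < i <= dimV n)%N).
Local Notation y := ((r^-1 * s) ^+ (2 * n - 1)).
Local Notation d1 := (rden1 r s u).

(* [al_swap a b]: the coefficient of E_aa (x) E_bb carries the factor r^2 s^2. *)
Definition al_swap (a b : nat) : bool :=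
  [|| [&& a <= n, b <= n & a < b], [&& a <= n, n.+1 < b & 2 * n + 2 < a + b],
      [&& n.+1 < a, b <= n & a + b < 2 * n + 2] | [&& n.+1 < a, n.+1 < b & b < a]]%N.

Definition al_coef (a b : nat) : F :=
  (u - 1) / d1 * (if (a == n.+1) || (b == n.+1) then r * s
                  else if al_swap a b then r ^+ 2 * s ^+ 2 else 1).

Definition be_coef (a b : nat) : F :=
  (r ^+ 2 - s ^+ 2) / d1 * (if (a < b)%N then 1 else u).

(** The zero weight block, with row v_b' (x) v_b and column v_d' (x) v_d. *)
Definition Z_coef (b d : nat) : F :=
  (rden2 n r s u * d1)^-1 * d_coef n r s sr ss u b d.

(* (s / r)^rho_i *)
Definition rho_pow (i : nat) : F := q_half sr ss (rho2 n i).

Local Notation X := rho_pow.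

Hypotheses (n_ge3 : (3 <= n)%N) (sr0 : sr != 0) (ss0 : ss != 0) (u0 : u != 0).
Hypotheses (rE : r = sr ^+ 2) (sE : s = ss ^+ 2).
Hypotheses (d1_neq0 : d1 != 0) (d2_neq0 : rden2 n r s u != 0).

Lemma q_half_neq0 : sr^-1 * ss != 0.
Proof. by rewrite mulf_neq0 ?invr_neq0. Qed.

Lemma rho_pow_neq0 i : X i != 0.
Proof. by rewrite expfz_neq0 ?q_half_neq0. Qed.

Lemma rho_pow_prime i : in_range i -> X i^' = (X i)^-1.
Proof.
move=> i_in; rewrite /X /q_half invr_expz; congr (_ ^ _).
rewrite /rho2 /prime_ix; move: i_in => ?.
by case: ifP => ?; case: ifP => ?; repeat case: ifP => ?; nlia.
Qed.

Lemma rho_pow_succ i : (0 < i < n)%N -> X i.+1 = X i * r / s.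
Proof.
move=> i_in; have -> : X i = X i.+1 * (sr^-1 * ss) ^ 2.
  rewrite /X /q_half -expfzDr ?q_half_neq0 //; congr (_ ^ _); rewrite /rho2.
  by rewrite !ifT; nlia.
rewrite rE sE -exprnP; field; by rewrite ?sr0 ?ss0.
Qed.

Lemma rho_pow_n : X n = ss / sr.
Proof. rewrite /X /q_half /rho2 leqnn (_ : _ - _ = 1) ?expr1z 1?mulrC //; nlia. Qed.

Lemma rho_pow_mid : X n.+1 = 1.
Proof. by rewrite /X /q_half /rho2 ltnn eqxx expr0z. Qed.

(** From 2 rho_1 = 2n - 1. This ties y to the powers q^(rho_i) and serves at the affine node. *)
Lemma rho_pow1_sqr : X 1 ^+ 2 = y.
Proof.
rewrite /X /q_half /rho2 ifT; last by nlia.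
have -> : r^-1 * s = (sr^-1 * ss) ^+ 2 by rewrite rE sE exprMn exprVn.
rewrite -exprM !exprnP exprz_exp; congr (_ ^ _); nlia.
Qed.

(** Every power of q is expressed by y = q^(2n-1) and X i = q^(rho_i), so that the identities to
    come are rational in finitely many quantities, whatever n is. *)
Lemma Z_coefE b d : Z_coef b d = ((u - y) * d1)^-1 *
  if (b < d)%N then (s ^+ 2 - r ^+ 2) * u *
      ((u - 1) * X b / X d - if b == (d^')%N then u - y else 0)
  else if (d < b)%N then (s ^+ 2 - r ^+ 2) *
      ((u - 1) * y * X b / X d - if b == (d^')%N then u - y else 0)
  else if b != (b^')%N then s ^+ 2 * (u - 1) * (u - y * r ^+ 2 / s ^+ 2)
  else r * s * (u - 1) * (u - y) + (r ^+ 2 - s ^+ 2) * u * (1 - y).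
Proof.
rewrite /Z_coef /d_coef /rden2.
have qD i j : q_half sr ss (rho2 n i - rho2 n j) = X i / X j.
  by rewrite /X /q_half expfzDr ?q_half_neq0 // -invr_expz.
have qD2 i j : q_half sr ss (2 * (2 * n - 1)%:Z + rho2 n i - rho2 n j) = y * X i / X j.
  rewrite -addrA {1}/q_half expfzDr ?q_half_neq0 // -!/(q_half _ _ _) qD mulrA; congr (_ * _ / _).
  have -> : r^-1 * s = (sr^-1 * ss) ^+ 2 by rewrite rE sE exprMn exprVn.
  by rewrite -exprM exprnP.
have y3 : (r^-1 * s) ^+ (2 * n - 3) = y * r ^+ 2 / s ^+ 2.
  have -> : (2 * n - 1 = 2 * n - 3 + 2)%N by nlia.
  by rewrite exprD; field; rewrite (sqrt_neq0 sr0 rE) (sqrt_neq0 ss0 sE).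
congr (_ * _); case: ifP => _; first by rewrite qD; case: ifP => _; rewrite ?mul1r ?mul0r; ring.
case: ifP => _; first by rewrite qD2; case: ifP => _; rewrite ?mul1r ?mul0r; ring.
by case: ifP => _; rewrite ?y3.
Qed.
End Coefficients.

(** * The scalar identities at the three kinds of nodes *)

Section Local.
Variables (F : fieldType) (n : nat) (r s sr ss u : F).
Local Notation "i ^'" := (prime_ix n i) : nat_scope.
Local Notation in_range i := (is_true (0 < i <= dimV n)%N).
Local Notation y := ((r^-1 * s) ^+ (2 * n - 1)).
Local Notation d1 := (rden1 r s u).
Local Notation al := (al_coef n r s u).
Local Notation be := (be_coef r s u).
Local Notation Z := (Z_coef n r s sr ss u).
Local Notation X := (rho_pow n sr ss).

(** The three functions [om_mid], [om_last], [om_zero] give the eigenvalue on v_a of omega_i for 0 <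
    i < n, of omega_n and of omega_0; see [mx_omegaE]. *)
Definition om_mid (i a : nat) : F :=
  if a == i then r ^+ 2 else if a == i.+1 then s ^+ 2
  else if a == i.+1^' then s ^- 2 else if a == i^' then r ^- 2 else 1.

Definition om_last (a : nat) : F :=
  if a == n then r / s else if a == n.+1 then 1
  else if a == n^' then s / r else if (a < n)%N then (r * s)^-1 else r * s.

Definition om_zero (a : nat) : F :=
  if a == 1 then s ^+ 2 else if a == 2 then r ^- 2
  else if (a <= n)%N then (r * s) ^- 2 else if a == n.+1 then 1
  else if a == 1^' then s ^- 2 else if a == 2^' then r ^+ 2
  else (r * s) ^+ 2.

Hypotheses (n_ge3 : (3 <= n)%N) (sr0 : sr != 0) (ss0 : ss != 0) (u0 : u != 0).
Hypotheses (rE : r = sr ^+ 2) (sE : s = ss ^+ 2).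
Hypotheses (d1_neq0 : d1 != 0) (d2_neq0 : rden2 n r s u != 0).

Let r_neq0 : r != 0. Proof. exact: sqrt_neq0 sr0 rE. Qed.
Let s_neq0 : s != 0. Proof. exact: sqrt_neq0 ss0 sE. Qed.
Let y_neq0 : y != 0.
Proof. by rewrite expf_neq0 // mulf_neq0 // invr_eq0. Qed.

Let d1' : r ^+ 2 * u - s ^+ 2 != 0. Proof. exact: d1_neq0. Qed.
Ltac fld := rewrite /rden1; field; rewrite ?d1' ?r_neq0 ?s_neq0 ?u0 //=.

Let d1'' : sr ^+ 4 * u - ss ^+ 4 != 0.
Proof. by have := d1'; rewrite rE sE -!exprM. Qed.
Let d2' : u - y != 0. Proof. exact: d2_neq0. Qed.
(** For i > 0 the identities hold with y replaced by an indeterminate different from u. At the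
    affine node [zstart1] replaces y by X_1^2 instead. *)
Ltac zstart := rewrite !(Z_coefE _ n_ge3 sr0 ss0 rE sE); move: d2'; generalize y => Y d2Y.
Ltac zside := repeat (apply/andP; split); first [ assumption | exact: d1' | exact: d1'' | exact: r_neq0 | exact: oner_neq0 ].
Ltac zfld := rewrite /rden1; field; zside.

Ltac zstart1 := rewrite !(Z_coefE _ n_ge3 sr0 ss0 rE sE); move: d2';
  rewrite -(rho_pow1_sqr n_ge3 rE sE) => d2Y.

Section Mid.
Variable i : nat.
Hypothesis i_in : (0 < i < n)%N.

Ltac zfin XE := rewrite /al_coef /be_coef /al_swap /om_mid; cases_if; rewrite ?XE; zfld.

(** [XE] expresses q^(rho) at the four moved indices by its value at i. All coefficients have a
    fixed form once the free index is located: five ranges in [ice_far], because [al] also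
    distinguishes the middle index, and three around the moved indices in the zero weight block. *)
Lemma mid_local : ice_local n al be Z (om_mid i) i i.+1 1 (- (r * s)^-1) 1.
Proof.
have XE : (X i^' = (X i)^-1) * (X i.+1 = X i * r / s) * (X i.+1^' = (X i)^-1 * s / r).
  split; [split|]; [by rewrite rho_pow_prime //; nlia | exact: (rho_pow_succ n_ge3 sr0 ss0 rE sE) |].
  rewrite rho_pow_prime //; last by nlia.
  by rewrite (rho_pow_succ n_ge3 sr0 ss0 rE sE) //; fld; rewrite rho_pow_neq0.
have x0 := rho_pow_neq0 n sr0 ss0 i.
split.
- move=> d d_in dN.
  have {dN} : [|| (d < i), (i.+1 < d <= n), (d == n.+1), (n.+1 < d < i.+1^') | (i^' < d)]%N by nlia.
  case/orP=> [|/or4P[]] dR; (split; split; rewrite /al_coef /be_coef /al_swap /om_mid; cases_if; fld).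
- split; rewrite /al_coef /be_coef /al_swap /om_mid; cases_if; fld.
- split; rewrite /al_coef /be_coef /al_swap /om_mid; cases_if; fld.
- split; rewrite /al_coef /be_coef /al_swap /om_mid; cases_if; fld.
- split; rewrite /al_coef /be_coef /al_swap /om_mid; cases_if; fld.
- move=> c c_in; zstart.
  have [ce|?] := eqVneq c i.
    rewrite {}ce; zfin XE.
  have [ce|?] := eqVneq c i.+1.
    rewrite {}ce; zfin XE.
  have [ce|?] := eqVneq c (i^')%N.
    rewrite {}ce (_ : i^'^' = i)%N; last by nlia.
    zfin XE.
  have [ce|?] := eqVneq c (i.+1^')%N.
    rewrite {}ce (_ : i.+1^'^' = i.+1)%N; last by nlia.
    zfin XE.
  have : [|| (c^' < i), (i.+1 < c^' < i.+1^') | (i^' < c^')]%N by nlia.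
  have xc0 := rho_pow_neq0 n sr0 ss0 c^'.
  by case/or3P=> dR; zfin XE.
- move=> c c_in; zstart.
  have [ce|?] := eqVneq c i.
    rewrite {}ce; zfin XE.
  have [ce|?] := eqVneq c i.+1.
    rewrite {}ce; zfin XE.
  have [ce|?] := eqVneq c (i^')%N.
    rewrite {}ce (_ : i^'^' = i)%N; last by nlia.
    zfin XE.
  have [ce|?] := eqVneq c (i.+1^')%N.
    rewrite {}ce (_ : i.+1^'^' = i.+1)%N; last by nlia.
    zfin XE.
  have : [|| (c^' < i), (i.+1 < c^' < i.+1^') | (i^' < c^')]%N by nlia.
  have xc0 := rho_pow_neq0 n sr0 ss0 c^'.
  by case/or3P=> dR; zfin XE.
- move=> b b_in; zstart.
  have [be|?] := eqVneq b (i)%N.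
    rewrite {}be; zfin XE.
  have [be|?] := eqVneq b (i.+1)%N.
    rewrite {}be; zfin XE.
  have [be|?] := eqVneq b (i^')%N.
    rewrite {}be; zfin XE.
  have [be|?] := eqVneq b (i.+1^')%N.
    rewrite {}be; zfin XE.
  have : [|| (b < i), (i.+1 < b < i.+1^') | (i^' < b)]%N by nlia.
  have xb0 := rho_pow_neq0 n sr0 ss0 b.
  by case/or3P=> dR; zfin XE.
- move=> b b_in; zstart.
  have [be|?] := eqVneq b (i)%N.
    rewrite {}be; zfin XE.
  have [be|?] := eqVneq b (i.+1)%N.
    rewrite {}be; zfin XE.
  have [be|?] := eqVneq b (i^')%N.
    rewrite {}be; zfin XE.
  have [be|?] := eqVneq b (i.+1^')%N.
    rewrite {}be; zfin XE.
  have : [|| (b < i), (i.+1 < b < i.+1^') | (i^' < b)]%N by nlia.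
  have xb0 := rho_pow_neq0 n sr0 ss0 b.
  by case/or3P=> dR; zfin XE.
Qed.
End Mid.

Section Last.
Let midK : (n.+1^' = n.+1)%N. Proof. nlia. Qed.

Ltac lfin XE := rewrite /al_coef /be_coef /al_swap /om_last; cases_if;
  rewrite ?XE /rden1 rE sE; field; rewrite -?exprM; zside.

(** Here q = n + 1 = q', so [ice_qq] and [ice_from_qq] hold vacuously. As q^(rho_n) = ss / sr
    involves square roots, r and s are replaced by the squares of [sr] and [ss] before [field]. *)
Lemma last_local : ice_local n al be Z om_last n n.+1 (sr * ss)^-1 (- r^-1) 1.
Proof.
have XE : (X n^' = (X n)^-1) * (X n.+1 = 1) * (X n = ss / sr).
  by split; [split; [rewrite rho_pow_prime //; nlia | exact: rho_pow_mid] | exact: rho_pow_n].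
split; rewrite ?midK.
- move=> d d_in dN.
  have {dN} : ((d < n) || (n^' < d))%N by nlia.
  by case/orP=> dR; (split; split; lfin XE).
- by split; lfin XE.
- by rewrite eqxx.
- by rewrite eqxx.
- by split; lfin XE.
- move=> c c_in; zstart.
  have [ce|?] := eqVneq c n.
    rewrite {}ce; lfin XE.
  have [ce|?] := eqVneq c n.+1.
    rewrite {}ce midK; lfin XE.
  have [ce|?] := eqVneq c (n^')%N.
    rewrite {}ce (_ : n^'^' = n)%N; last by nlia.
    lfin XE.
  have : ((c^' < n) || (n^' < c^'))%N by nlia.
  have xc0 := rho_pow_neq0 n sr0 ss0 c^'.
  by case/orP=> dR; lfin XE.
- move=> c c_in; zstart.
  have [ce|?] := eqVneq c n.
    rewrite {}ce; lfin XE.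
  have [ce|?] := eqVneq c n.+1.
    rewrite {}ce midK; lfin XE.
  have [ce|?] := eqVneq c (n^')%N.
    rewrite {}ce (_ : n^'^' = n)%N; last by nlia.
    lfin XE.
  have : ((c^' < n) || (n^' < c^'))%N by nlia.
  have xc0 := rho_pow_neq0 n sr0 ss0 c^'.
  by case/orP=> dR; lfin XE.
- move=> b b_in; zstart.
  have [be|?] := eqVneq b n.
    rewrite {}be; lfin XE.
  have [be|?] := eqVneq b n.+1.
    rewrite {}be; lfin XE.
  have [be|?] := eqVneq b (n^')%N.
    rewrite {}be; lfin XE.
  have : ((b < n) || (n^' < b))%N by nlia.
  have xb0 := rho_pow_neq0 n sr0 ss0 b.
  by case/orP=> dR; lfin XE.
- move=> b b_in; zstart.
  have [be|?] := eqVneq b n.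
    rewrite {}be; lfin XE.
  have [be|?] := eqVneq b n.+1.
    rewrite {}be; lfin XE.
  have [be|?] := eqVneq b (n^')%N.
    rewrite {}be; lfin XE.
  have : ((b < n) || (n^' < b))%N by nlia.
  have xb0 := rho_pow_neq0 n sr0 ss0 b.
  by case/orP=> dR; lfin XE.
Qed.
End Last.

Section Zero.
Let oneK : (1^'^' = 1)%N. Proof. nlia. Qed.

Ltac ofin XE := rewrite /al_coef /be_coef /al_swap /om_zero; cases_if; rewrite ?XE; zfld.

(** The moved indices 1, 2, 2', 1' are the outermost ones, so the free index always lies strictly
    between 2 and 2'. The parameter t is u, since e_0 is proportional to the spectral parameter. *)
Lemma zero_local : ice_local n al be Z om_zero 1^' 2 1 (- (r * s)) u.
Proof.
have XE : (X 1^' = (X 1)^-1) * (X 2 = X 1 * r / s) * (X 2^' = (X 1)^-1 * s / r).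
  split; [split|]; [by rewrite rho_pow_prime //; nlia | by apply: (rho_pow_succ n_ge3 sr0 ss0 rE sE); nlia |].
  rewrite rho_pow_prime //; last by nlia.
  by rewrite (rho_pow_succ n_ge3 sr0 ss0 rE sE) //; [fld; rewrite rho_pow_neq0 | nlia].
have x0 := rho_pow_neq0 n sr0 ss0 1.
split; rewrite ?oneK.
- move=> d d_in dN.
  have {dN} : [|| (2 < d <= n), (d == n.+1) | (n.+1 < d < 2^')]%N by nlia.
  by case/or3P=> dR; (split; split; ofin XE).
- by split; ofin XE.
- by split; ofin XE.
- by split; ofin XE.
- by split; ofin XE.
- move=> c c_in; zstart1.
  have [ce|?] := eqVneq c 1.
    rewrite {}ce; ofin XE.
  have [ce|?] := eqVneq c 2.
    rewrite {}ce; ofin XE.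
  have [ce|?] := eqVneq c (1^')%N.
    rewrite {}ce (_ : 1^'^' = 1)%N; last by nlia.
    ofin XE.
  have [ce|?] := eqVneq c (2^')%N.
    rewrite {}ce (_ : 2^'^' = 2)%N; last by nlia.
    ofin XE.
  have dR : (2 < c^' < 2^')%N by nlia.
  have xc0 := rho_pow_neq0 n sr0 ss0 c^'.
  by ofin XE.
- move=> c c_in; zstart1.
  have [ce|?] := eqVneq c 1.
    rewrite {}ce; ofin XE.
  have [ce|?] := eqVneq c 2.
    rewrite {}ce; ofin XE.
  have [ce|?] := eqVneq c (1^')%N.
    rewrite {}ce (_ : 1^'^' = 1)%N; last by nlia.
    ofin XE.
  have [ce|?] := eqVneq c (2^')%N.
    rewrite {}ce (_ : 2^'^' = 2)%N; last by nlia.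
    ofin XE.
  have dR : (2 < c^' < 2^')%N by nlia.
  have xc0 := rho_pow_neq0 n sr0 ss0 c^'.
  by ofin XE.
- move=> b b_in; zstart1.
  have [be|?] := eqVneq b (1)%N.
    rewrite {}be; ofin XE.
  have [be|?] := eqVneq b (2)%N.
    rewrite {}be; ofin XE.
  have [be|?] := eqVneq b (1^')%N.
    rewrite {}be; ofin XE.
  have [be|?] := eqVneq b (2^')%N.
    rewrite {}be; ofin XE.
  have dR : (2 < b < 2^')%N by nlia.
  have xb0 := rho_pow_neq0 n sr0 ss0 b.
  by ofin XE.
- move=> b b_in; zstart1.
  have [be|?] := eqVneq b (1)%N.
    rewrite {}be; ofin XE.
  have [be|?] := eqVneq b (2)%N.
    rewrite {}be; ofin XE.
  have [be|?] := eqVneq b (1^')%N.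
    rewrite {}be; ofin XE.
  have [be|?] := eqVneq b (2^')%N.
    rewrite {}be; ofin XE.
  have dR : (2 < b < 2^')%N by nlia.
  have xb0 := rho_pow_neq0 n sr0 ss0 b.
  by ofin XE.
Qed.
End Zero.
End Local.

(** * The entries of the R-matrix *)

Section Entries.
Variables (F : fieldType) (n : nat) (r s sr ss u : F).
Local Notation "i ^'" := (prime_ix n i) : nat_scope.
Local Notation in_range i := (is_true (0 < i <= dimV n)%N).
Local Notation N := (dimV n).
Local Notation E := (unit_mx F n).

Lemma sum_pick (V : nmodType) (P : pred nat) (f : nat -> V) x : in_range x ->
  (forall i : nat, i != x -> f i = 0) ->
  \sum_(1 <= i < N.+1 | P i) f i = if P x then f x else 0.
Proof.
move=> x_in f0; rewrite big_mkcond (bigD1_seq x) ?iota_uniq ?mem_index_iota //=.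
by rewrite big1 ?addr0 // => i /f0 ->; case: ifP.
Qed.

Lemma sum1_mxE m (P : pred nat) (M : nat -> 'M[F]_m) k l x : in_range x ->
  (forall i : nat, i != x -> M i k l = 0) ->
  (\sum_(1 <= i < N.+1 | P i) M i) k l = if P x then M x k l else 0.
Proof. by move=> x_in M0; rewrite summxE (sum_pick P x_in M0). Qed.

Lemma sum2_mxE m (P : nat -> nat -> bool) (M : nat -> nat -> 'M[F]_m) k l x y :
  in_range x -> in_range y ->
  (forall i j : nat, ~~ ((i == x) && (j == y)) -> M i j k l = 0) ->
  (\sum_(1 <= i < N.+1) \sum_(1 <= j < N.+1 | P i j) M i j) k l =
  if P x y then M x y k l else 0.
Proof.
move=> x_in y_in M0; rewrite (sum1_mxE xpredT x_in) /=.
  by rewrite (sum1_mxE (P x) y_in) // => j jy; rewrite M0 // eqxx.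
move=> i ix; rewrite summxE big1 // => j _; by rewrite M0 // (negPf ix).
Qed.

Lemma unit_tensE i j k l (a b c d : 'I_N) :
  (E i j *t E k l) (mxtens_index (a, b)) (mxtens_index (c, d)) =
  ([&& a.+1 == i, c.+1 == j, b.+1 == k & d.+1 == l])%:R.
Proof. by rewrite tensmxE !mxE -natrM mulnb -andbA. Qed.

(** The sets A and B, their transposes and the pairs containing n + 1 partition the pairs (a, b)
    with b different from a and a'; each class contributes its own factor to E_aa (x) E_bb. *)
Lemma diag_coef_sum a b : in_range a -> in_range b ->
  (set_A n b a)%:R + (set_B n a b)%:R
  + r ^+ 2 * s ^+ 2 * ((set_A n a b)%:R + (set_B n b a)%:R)
  + r * s * (((a == n.+1) && (b != b^')%N)%:R + ((b == n.+1) && (a != a^')%N)%:R)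
  = if (b == a^')%N || (a == b) then 0 else
    if (a == n.+1) || (b == n.+1) then r * s
    else if al_swap n a b then r ^+ 2 * s ^+ 2 else 1.
Proof.
move=> a_in b_in; rewrite /set_A /set_B /al_swap.
have : [|| (a <= n), (a == n.+1) | (n.+1 < a)]%N by nlia.
have : [|| (b <= n), (b == n.+1) | (n.+1 < b)]%N by nlia.
have rg (P : bool) : P%:R = (if P then 1 else 0 : F) by case: P.
rewrite !rg.
by case/or3P=> bR; case/or3P=> aR; cases_if; ring.
Qed.
End Entries.

Section RHatEntries.
Variables (F : fieldType) (n : nat) (r s sr ss u : F).
Local Notation "i ^'" := (prime_ix n i) : nat_scope.
Local Notation in_range i := (is_true (0 < i <= dimV n)%N).
Local Notation N := (dimV n).
Local Notation E := (unit_mx F n).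
Local Notation d1 := (rden1 r s u).

(** At a given entry each sum has at most one nonzero term, found by matching the indices of the
    matrix units with a, b, c, d. *)
Lemma R_hatE (a b c d : 'I_N) :
  R_hat n r s sr ss u (mxtens_index (a, b)) (mxtens_index (c, d)) =
  ice n (al_coef n r s u) (be_coef r s u) (Z_coef n r s sr ss u)
    a.+1 b.+1 c.+1 d.+1.
Proof.
have ord_in (i : 'I_N) : in_range i.+1 by case: i => i /=; lia.
have [[[aI bI] cI] dI] := (ord_in a, ord_in b, ord_in c, ord_in d).
have sc (x : F) m (A : 'M[F]_m) i j : (x *: A) i j = x * A i j by rewrite mxE.
have ad m (A B : 'M[F]_m) i j : (A + B) i j = A i j + B i j by rewrite mxE.
rewrite /R_hat !(sc, ad) big_split /= !ad.
have off (P : bool) : ~~ P -> P%:R = 0 :> F by case: P.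
rewrite (sum1_mxE _ aI); last by move=> i ix; rewrite unit_tensE off //; lia.
rewrite (sum2_mxE _ bI aI); last by move=> i j ix; rewrite unit_tensE off //; lia.
rewrite (sum2_mxE _ aI bI); last by move=> i j ix; rewrite unit_tensE off //; lia.
rewrite (sum2_mxE _ aI bI); last by move=> i j ix; rewrite unit_tensE off //; lia.
rewrite (sum2_mxE _ bI aI); last by move=> i j ix; rewrite unit_tensE off //; lia.
rewrite (sum1_mxE _ bI); last by move=> i ix; rewrite unit_tensE off //; lia.
rewrite (sum1_mxE _ aI); last by move=> i ix; rewrite unit_tensE off //; lia.
rewrite (sum2_mxE _ aI bI); last by move=> i j ix; rewrite unit_tensE off //; lia.
rewrite (sum2_mxE _ aI bI); last by move=> i j ix; rewrite unit_tensE off //; lia.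
rewrite (sum2_mxE _ bI dI); last by move=> i j ix; rewrite sc unit_tensE off ?mulr0 //; lia.
rewrite sc !unit_tensE.
have G := @diag_coef_sum F n r s _ _ aI bI.
move: G aI bI cI dI; rewrite -/d1.
move: (a.+1) (b.+1) (c.+1) (d.+1) => {ord_in}a1 b1 c1 d1' G aI bI cI dI.
rewrite !eqxx /= andbT /ice /Z_coef /al_coef /be_coef.
have ifE' (P : bool) (x : F) : (if P then x else 0) = P%:R * x.
  by case: P; rewrite ?mul1r ?mul0r.
have -> : (a1 == b1^')%N && (c1 == d1'^')%N = (b1 == a1^')%N && (d1' == c1^')%N.
  by clear -aI bI cI dI; congr (_ && _); nlia.
(* On the diagonal the terms of A, B and the middle index combine by [G]; for b = a' only the zero
   weight block remains. *)
have [/andP[/eqP ca /eqP db]|N1] := boolP ((c1 == a1) && (d1' == b1)).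
  have tE (x : nat) : [&& a1 == x, c1 == x & d1' == b1] = (a1 == x).
    by rewrite ca db eqxx andbT andbb.
  have tE' (x : nat) : [&& c1 == a1, b1 == x & d1' == x] = (b1 == x).
    by rewrite ca db eqxx /= andbb.
  rewrite tE !tE' ca db !eqxx /= !ifE' !mulr1.
  have -> : (b1 != b1^')%N%:R * (a1 == n.+1)%:R = ((a1 == n.+1) && (b1 != b1^')%N)%:R :> F.
    by rewrite -natrM mulnb andbC.
  have -> : (a1 != a1^')%N%:R * (b1 == n.+1)%:R = ((b1 == n.+1) && (a1 != a1^')%N)%:R :> F.
    by rewrite -natrM mulnb andbC.
  rewrite {}G; clear -aI bI.
  have [ba|ba] := eqVneq b1 (a1^')%N.
    rewrite ?andbF ?andbT /=.
    rewrite -natrM mulnb.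
    have -> : (a1 != a1^')%N && (b1 == a1) = false by clear -ba aI bI; nlia.
    by rewrite /=; ring.
  rewrite ?andbF ?andbT /=.
  have [ab|ab] := eqVneq a1 b1.
    have -> : (a1 != a1^')%N by rewrite {1}ab.
    by rewrite ab ltnn /=; ring.
  by rewrite /= ?andbF; ring.
(* Off the diagonal all terms E_ii (x) E_jj vanish; the exchange terms and the zero weight block
   remain. *)
have -> : [&& c1 == a1, b1 == a1 & d1' == a1] = false by clear -N1; nlia.
have -> : [&& a1 == n.+1, c1 == n.+1 & d1' == b1] = false by clear -N1; nlia.
have -> : [&& c1 == a1, b1 == n.+1 & d1' == n.+1] = false by clear -N1; nlia.
rewrite ![c1 == a1]eq_sym ![d1' == b1]eq_sym in N1 *.
rewrite (negbTE N1) ![a1 == d1']eq_sym ![b1 == c1]eq_sym [(d1' == a1) && _]andbC !ifE' /=.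
have [dc|dc] := eqVneq d1' (c1^')%N.
  have [ba|ba] := eqVneq b1 (a1^')%N.
    by rewrite ?andbF /=; ring.
  have -> : (c1 == b1) && (d1' == a1) = false by clear -ba dc aI bI cI dI; nlia.
  by rewrite /=; ring.
rewrite andbF.
have [/andP[/eqP cb /eqP da]|N2] := boolP ((c1 == b1) && (d1' == a1)); last by rewrite /=; ring.
have -> : (a1^' != b1)%N by rewrite cb da in dc; clear -dc aI bI; nlia.
have ab : a1 != b1 by rewrite cb da in N1; clear -N1; nlia.
case: ltngtP ab => // _ _; by rewrite /=; ring.
Qed.
End RHatEntries.

(** * From entries to identities between matrices *)

Lemma sum_mxtens (V : nmodType) (m k : nat) (f : 'I_(m * k) -> V) :
  \sum_l f l = \sum_i \sum_j f (mxtens_index (i, j)).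
Proof.
rewrite pair_bigA /= (reindex (@mxtens_index m k)) /=.
  by apply: eq_bigr => -[].
exists (@mxtens_unindex m k) => x _; [exact: mxtens_indexK | exact: mxtens_unindexK].
Qed.

Section Matrices.
Variables (F : fieldType) (n : nat).
Local Notation "i ^'" := (prime_ix n i) : nat_scope.
Local Notation in_range i := (is_true (0 < i <= dimV n)%N).
Local Notation N := (dimV n).
Local Notation E := (unit_mx F n).

Definition ix (p : nat) : 'I_N := inord p.-1.

Lemma ixE p : in_range p -> (ix p).+1 = p.
Proof. by move=> p_in; rewrite /ix inordK; nlia. Qed.

Lemma ix_eq p (a : 'I_N) : in_range p -> (a == ix p) = (a.+1 == p).
Proof. by move=> p_in; rewrite -val_eqE /= -eqSS ixE. Qed.

(** The two legs are summed one after the other, so that diagonal, unit and root matrices are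
    evaluated leg by leg. *)
Lemma mul_tensr (M : 'M[F]_(N * N)) (A B : 'M[F]_N) a b c d :
  (M *m (A *t B)) (mxtens_index (a, b)) (mxtens_index (c, d)) =
  \sum_i A i c * \sum_j B j d * M (mxtens_index (a, b)) (mxtens_index (i, j)).
Proof.
rewrite mxE sum_mxtens; apply: eq_bigr => i _; rewrite mulr_sumr.
by apply: eq_bigr => j _; rewrite tensmxE mulrC mulrA.
Qed.

Lemma mul_tensl k (M : 'M[F]_(N * N, k)) (A B : 'M[F]_N) a b c :
  ((A *t B) *m M) (mxtens_index (a, b)) c =
  \sum_i A a i * \sum_j B b j * M (mxtens_index (i, j)) c.
Proof.
rewrite mxE sum_mxtens; apply: eq_bigr => i _; rewrite mulr_sumr.
by apply: eq_bigr => j _; rewrite tensmxE mulrA.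
Qed.

Definition diag (om : nat -> F) : 'M[F]_N := \matrix_(i, j) ((i == j)%:R * om i.+1).

Definition root_mx (p q : nat) (c1 c2 : F) : 'M[F]_N :=
  c1 *: E p q + c2 *: E q^' p^'.

Lemma sum_delta (f : 'I_N -> F) i : \sum_j (j == i)%:R * f j = f i.
Proof.
rewrite (bigD1 i) //= eqxx mul1r big1 ?addr0 // => j /negbTE ->.
by rewrite mul0r.
Qed.

Lemma sum_diagr om (f : 'I_N -> F) c : \sum_i diag om i c * f i = om c.+1 * f c.
Proof.
rewrite -[RHS](sum_delta (fun i => om i.+1 * f i)).
by apply: eq_bigr => i _; rewrite mxE mulrA.
Qed.

Lemma sum_diagl om (f : 'I_N -> F) c : \sum_i diag om c i * f i = om c.+1 * f c.
Proof.
rewrite -[RHS](sum_delta (fun i => om c.+1 * f i)).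
by apply: eq_bigr => i _; rewrite mxE mulrA eq_sym.
Qed.

Lemma sum_1r (f : 'I_N -> F) c : \sum_i (1%:M : 'M[F]_N) i c * f i = f c.
Proof. by rewrite -[RHS]sum_delta; apply: eq_bigr => i _; rewrite mxE. Qed.

Lemma sum_1l (f : 'I_N -> F) c : \sum_i (1%:M : 'M[F]_N) c i * f i = f c.
Proof. by rewrite -[RHS]sum_delta; apply: eq_bigr => i _; rewrite mxE eq_sym. Qed.

Section Root.
Variables (p q : nat) (c1 c2 : F).
Hypotheses (p_in : in_range p) (q_in : in_range q).

Lemma sum_rootr (f : 'I_N -> F) c :
  \sum_i root_mx p q c1 c2 i c * f i =
  (if c.+1 == q then c1 * f (ix p) else 0)
  + (if c.+1 == p^' then c2 * f (ix q^') else 0).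
Proof.
have [p'_in q'_in] : in_range p^' /\ in_range q^' by split; nlia.
rewrite -(sum_delta f) -(sum_delta f (ix q^')) !if_natr !mulr_sumr -big_split /=.
apply: eq_bigr => i _; rewrite !mxE !ix_eq // -!mulnb !natrM; ring.
Qed.

Lemma sum_rootl (f : 'I_N -> F) a :
  \sum_i root_mx p q c1 c2 a i * f i =
  (if a.+1 == p then c1 * f (ix q) else 0)
  + (if a.+1 == q^' then c2 * f (ix p^') else 0).
Proof.
have [p'_in q'_in] : in_range p^' /\ in_range q^' by split; nlia.
rewrite -(sum_delta f) -(sum_delta f (ix p^')) !if_natr !mulr_sumr -big_split /=.
apply: eq_bigr => i _; rewrite !mxE !ix_eq // -!mulnb !natrM; ring.
Qed.
End Root.

Section RHat.
Variables (r s sr ss u : F).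
Local Notation Rh := (R_hat n r s sr ss u).
Local Notation al := (al_coef n r s u).
Local Notation be := (be_coef r s u).
Local Notation Z := (Z_coef n r s sr ss u).

Lemma R_hat_root (om : nat -> F) p q c1 c2 t :
  in_range p -> in_range q -> p <> p^'%N -> p <> q -> p <> q^'%N ->
  ice_local n al be Z om p q c1 c2 t ->
  let e := root_mx p q c1 c2 in
  Rh *m (t *: (e *t 1%:M) + diag om *t e) =
  (1%:M *t e + t *: (e *t diag om)) *m Rh.
Proof.
move=> p_in q_in ppN pqN pqpN loc e.
have ord_in (i : 'I_N) : in_range i.+1 by case: i => i /=; lia.
have [p'_in q'_in] : in_range p^' /\ in_range q^' by split; nlia.
have RE := @R_hatE F n r s sr ss u; move: (Rh) RE => M RE.
apply/matrixP => k l; case: (mxtens_indexP k) => a b; case: (mxtens_indexP l) => c d.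
rewrite mulmxDr mulmxDl -scalemxAr -scalemxAl.
have sc (x : F) m (A : 'M[F]_m) i j : (x *: A) i j = x * A i j by rewrite mxE.
have ad m (A B : 'M[F]_m) i j : (A + B) i j = A i j + B i j by rewrite mxE.
rewrite /e !(sc, ad) !mul_tensr !mul_tensl sum_1l sum_diagr !sum_rootr // !sum_rootl //.
rewrite !sum_1r !sum_diagl !RE !ixE //.
rewrite (ice_intertwine p_in q_in ppN pqN pqpN loc) //.
by congr (_ + _); rewrite -mulrA mulrDr; congr (_ * (_ + _)); case: ifP => _; ring.
Qed.

(** Outside the zero weight space the R-matrix only keeps or exchanges the two factors, which does
    not change the product of the two eigenvalues; on the zero weight space this product is 1. *)
Lemma R_hat_diag (om : nat -> F) : (forall i, in_range i -> om i * om i^' = 1) ->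
  Rh *m (diag om *t diag om) = (diag om *t diag om) *m Rh.
Proof.
move=> om1; have RE := @R_hatE F n r s sr ss u; move: (Rh) RE => M RE.
apply/matrixP => k l; case: (mxtens_indexP k) => a b; case: (mxtens_indexP l) => c d.
have ord_in (i : 'I_N) : in_range i.+1 by case: i => i /=; lia.
rewrite mul_tensr mul_tensl !sum_diagr !sum_diagl !RE.
move: (ord_in a) (ord_in b) (ord_in c) (ord_in d).
move: (a.+1) (b.+1) (c.+1) (d.+1) => a1 b1 c1 d2 aI bI cI dI.
rewrite /ice !mulrA; have [->|_] := eqVneq d2 (c1^')%N.
  rewrite om1 //; have [->|_] := eqVneq b1 (a1^')%N; last by rewrite !mulr0.
  by rewrite om1.
have [/andP[/eqP-> /eqP->]//|_] := boolP ((a1 == c1) && (b1 == d2)).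
have [/andP[/eqP-> /eqP->]|_] := boolP ((a1 == d2) && (b1 == c1)); last by rewrite !mulr0.
by rewrite [om c1 * _]mulrC.
Qed.
End RHat.
End Matrices.

(** * The symmetry that exchanges r and s *)

Section Transpose.
Variables (F : fieldType) (n : nat) (r s sr ss u : F).
Local Notation "i ^'" := (prime_ix n i) : nat_scope.
Local Notation in_range i := (is_true (0 < i <= dimV n)%N).
Local Notation N := (dimV n).
Hypotheses (n_ge3 : (3 <= n)%N) (sr0 : sr != 0) (ss0 : ss != 0) (u0 : u != 0).
Hypotheses (rE : r = sr ^+ 2) (sE : s = ss ^+ 2).
Hypotheses (d1_neq0 : rden1 r s u != 0) (d2_neq0 : rden2 n r s u != 0).

Let d1' : r ^+ 2 * u - s ^+ 2 != 0. Proof. exact: d1_neq0. Qed.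
Let r_neq0 : r != 0. Proof. exact: sqrt_neq0 sr0 rE. Qed.
Let s_neq0 : s != 0. Proof. exact: sqrt_neq0 ss0 sE. Qed.
Local Notation y := ((r^-1 * s) ^+ (2 * n - 1)).
Let y_neq0 : y != 0.
Proof. by rewrite expf_neq0 // mulf_neq0 // invr_eq0. Qed.

Lemma rden1_sym : rden1 s r u^-1 = - rden1 r s u / u.
Proof. by rewrite /rden1; field. Qed.

Lemma qpow_sym : (s^-1 * r) ^+ (2 * n - 1) = y^-1.
Proof. by rewrite -exprVn; congr (_ ^+ _); field; apply/andP. Qed.

Lemma rden2_sym : rden2 n s r u^-1 = - rden2 n r s u / (u * y).
Proof. by rewrite /rden2 qpow_sym; have := y_neq0; move: (y) => Y Y0; field; by rewrite ?u0 ?Y0. Qed.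

Lemma rden1_sym_neq0 : rden1 s r u^-1 != 0.
Proof. by rewrite rden1_sym mulf_neq0 ?oppr_eq0 ?invr_eq0. Qed.

Lemma rden2_sym_neq0 : rden2 n s r u^-1 != 0.
Proof. by rewrite rden2_sym mulf_neq0 ?oppr_eq0 ?invr_eq0 ?mulf_neq0. Qed.

Lemma al_coef_sym a b : al_coef n s r u^-1 a b = al_coef n r s u a b.
Proof.
rewrite /al_coef rden1_sym /rden1; case: ifP => _; [|case: ifP => _]; field; by rewrite ?oppr_eq0 ?u0 ?d1'.
Qed.

Lemma be_coef_sym a b : a <> b -> be_coef s r u^-1 b a = be_coef r s u a b.
Proof.
move=> ab; rewrite /be_coef rden1_sym /rden1.
have -> : (b < a)%N = ~~ (a < b)%N by lia.
case: (a < b)%N => /=; field; by rewrite ?oppr_eq0 ?u0 ?d1'.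
Qed.

Lemma rho_pow_sym i : rho_pow n ss sr i = (rho_pow n sr ss i)^-1.
Proof. by rewrite /rho_pow /q_half invr_expz -exprz_inv invfM invrK mulrC. Qed.

Lemma Z_coef_sym b d : in_range b -> in_range d ->
  Z_coef n s r ss sr u^-1 d b = Z_coef n r s sr ss u b d.
Proof.
move=> b_in d_in.
rewrite (Z_coefE _ n_ge3 ss0 sr0 sE rE) (Z_coefE _ n_ge3 sr0 ss0 rE sE).
have xb := rho_pow_neq0 n sr0 ss0 b; have xd := rho_pow_neq0 n sr0 ss0 d.
have d2 : u - y != 0 by exact: d2_neq0.
rewrite !rho_pow_sym qpow_sym rden1_sym.
have -> : u^-1 - y^-1 = - (u - y) / (u * y).
  by have := y_neq0; move: (y) => Y Y0; field; by rewrite ?u0 ?Y0.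
have -> : (d == b^')%N = (b == d^')%N by clear -b_in d_in; nlia.
rewrite /rden1.
have := y_neq0; move: (y) d2 => Y d2 Y0.
have [bd|bd|->] := ltngtP b d; last first.
  case: ifP => _; field; by rewrite ?oppr_eq0 ?oner_neq0 ?Y0 ?d2 ?d1' ?u0 ?r_neq0 ?s_neq0.
all: case: ifP => _; field; by rewrite ?oppr_eq0 ?oner_neq0 ?Y0 ?d2 ?d1' ?u0 ?xb ?xd ?r_neq0 ?s_neq0.
Qed.

(** Exchanging r and s inverts q, hence y and all q^(rho_i). With u inverted as well, the
    coefficients above and below the diagonal trade places, which the transposition undoes. *)
Lemma R_hat_sym : (R_hat n s r ss sr u^-1)^T = R_hat n r s sr ss u.
Proof.
have R1 := @R_hatE F n s r ss sr u^-1; move: (R_hat n s r ss sr u^-1) R1 => M1 R1.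
have R2 := @R_hatE F n r s sr ss u; move: (R_hat n r s sr ss u) R2 => M2 R2.
apply/matrixP => k l; rewrite mxE.
case: (mxtens_indexP k) => a b; case: (mxtens_indexP l) => c d; rewrite {}R1 {}R2.
have ord_in (i : 'I_N) : in_range i.+1 by case: i => i /=; lia.
move: (ord_in a) (ord_in b) (ord_in c) (ord_in d).
move: (a.+1) (b.+1) (c.+1) (d.+1) => a1 b1 c1 d2 aI bI cI dI.
rewrite /ice; have [ba|ba] := eqVneq b1 (a1^')%N; have [dc|dc] := eqVneq d2 (c1^')%N.
- exact: Z_coef_sym.
- by rewrite ifF 1?ifF //; clear -ba dc aI bI cI dI; nlia.
- by rewrite ifF 1?ifF //; clear -ba dc aI bI cI dI; nlia.
rewrite [a1 == c1]eq_sym [b1 == d2]eq_sym.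
case: ifP => [/andP[/eqP-> /eqP->]|N1].
  by case: ifP => // _; rewrite al_coef_sym.
rewrite [a1 == d2]eq_sym [b1 == c1]eq_sym [(d2 == a1) && _]andbC.
case: ifP => // /andP[/eqP cb /eqP da].
by rewrite cb da be_coef_sym // => ab; rewrite cb da ab eqxx in N1.
Qed.
End Transpose.

(** * The flip *)

Section Flip.
Variables (F : fieldType) (n : nat).
Local Notation in_range i := (is_true (0 < i <= dimV n)%N).
Local Notation N := (dimV n).

Lemma flip_mxE (a b c d : 'I_N) :
  flip_mx F n (mxtens_index (a, b)) (mxtens_index (c, d)) = ((a == d) && (b == c))%:R.
Proof.
have ord_in (i : 'I_N) : in_range i.+1 by case: i => i /=; lia.
rewrite /flip_mx (sum2_mxE _ (ord_in a) (ord_in b)); last first.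
  by move=> i j ij; rewrite unit_tensE; case: (boolP [&& _, _, _ & _]) => //; lia.
rewrite unit_tensE !eqxx /= !eqSS -!val_eqE /=; congr (nat_of_bool _)%:R; lia.
Qed.

Lemma flip_tens (A B : 'M[F]_N) :
  flip_mx F n *m (A *t B) = (B *t A) *m flip_mx F n.
Proof.
apply/matrixP => k l; case: (mxtens_indexP k) => a b; case: (mxtens_indexP l) => c d.
rewrite mul_tensr mul_tensl.
have EL : \sum_i A i c * (\sum_j B j d *
    flip_mx F n (mxtens_index (a, b)) (mxtens_index (i, j))) = A b c * B a d.
  rewrite -[A b c * _](sum_delta (fun i => A i c * B a d)); apply: eq_bigr => i _.
  rewrite -[B a d](sum_delta (fun j => B j d)) !mulr_sumr; apply: eq_bigr => j _.
  by rewrite flip_mxE -mulnb natrM [a == j]eq_sym [b == i]eq_sym; ring.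
rewrite {}EL; symmetry.
rewrite mulrC -[B a d * _](sum_delta (fun i => B a i * A b c)); apply: eq_bigr => i _.
rewrite -[A b c](sum_delta (fun j => A b j)) !mulr_sumr; apply: eq_bigr => j _.
by rewrite flip_mxE -mulnb natrM; ring.
Qed.
End Flip.

(** * The R-matrix and the images of the Chevalley generators *)

Section Generators.
Variables (F : fieldType) (n : nat).
Hypothesis n_ge3 : (3 <= n)%N.
Local Notation "i ^'" := (prime_ix n i) : nat_scope.
Local Notation in_range i := (is_true (0 < i <= dimV n)%N).
Local Notation N := (dimV n).
Local Notation E := (unit_mx F n).

Lemma unit_diag j : E j j = diag n (fun x => if x == j then 1 else 0).
Proof.
apply/matrixP => a b; rewrite !mxE -val_eqE /=.
have -> : (a.+1 == j) && (b.+1 == j) = (val a == val b) && (a.+1 == j) by rewrite /=; lia.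
by rewrite -mulnb natrM; case: (a.+1 == j).
Qed.

Lemma diagD f g : diag n f + diag n g = diag n (fun x => f x + g x) :> 'M[F]_N.
Proof. by apply/matrixP => a b; rewrite !mxE mulrDr. Qed.

Lemma diagZ c f : c *: diag n f = diag n (fun x => c * f x) :> 'M[F]_N.
Proof. by apply/matrixP => a b; rewrite !mxE mulrCA. Qed.

Lemma sum_unit_diag (P : pred nat) m k :
  \sum_(m <= j < k | P j) E j j =
  diag n (fun x => if (m <= x < k)%N && P x then 1 else 0).
Proof.
apply/matrixP => a b; rewrite summxE -big_filter mxE.
have [ain|aout] := boolP ((m <= a.+1 < k)%N && P a.+1); last first.
  rewrite mulr0 big_seq big1 // => j; rewrite mem_filter mem_index_iota => /andP[Pj jm].
  by rewrite mxE; case: eqP => //= aj; rewrite aj jm Pj in aout.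
rewrite (bigD1_seq a.+1) ?filter_uniq ?iota_uniq //=; last first.
  by rewrite mem_filter mem_index_iota andbC.
rewrite big1 ?addr0 => [|j ja]; first by rewrite mxE eqxx mulr1 /= eqSS eq_sym.
by rewrite mxE eq_sym (negbTE ja).
Qed.

Lemma eq_diag (f g : nat -> F) : (forall x, in_range x -> f x = g x) -> diag n f = diag n g.
Proof.
move=> fg; apply/matrixP => a b; rewrite !mxE fg //.
by case: (a) => a' /=; lia.
Qed.

Definition diagE := (unit_diag, sum_unit_diag, diagZ, diagD).

Section Params.
Variables (r s : F).

Lemma omega_mid i : (0 < i < n)%N ->
  mx_omega_swap n r s i = diag n (om_mid n r s i).
Proof.
move=> i_in; rewrite /mx_omega_swap ifF; last by lia.
rewrite !diagE; apply: eq_diag => x x_in; rewrite !inE /om_mid.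
cases_if; ring.
Qed.

Lemma omega_zero : mx_omega_swap n r s 0 = diag n (om_zero n r s).
Proof.
rewrite /mx_omega_swap /= !diagE; apply: eq_diag => x x_in; rewrite /om_zero.
cases_if; ring.
Qed.

Lemma omega_last : mx_omega n r s n = diag n (om_last n r s).
Proof.
rewrite /mx_omega eqxx !diagE; apply: eq_diag => x x_in; rewrite /om_last.
cases_if; ring.
Qed.

(** This includes i = n: there the coefficients rs and 1/(rs) are symmetric, and only the entries at
    n and n' change. *)
Lemma mx_omegap_sym i : mx_omegap n r s i = mx_omega n s r i.
Proof.
rewrite /mx_omegap /mx_omega; case: ifP => // _.
by rewrite [s * r]mulrC ![s * r^-1]mulrC [s^-1 * r]mulrC.
Qed.
End Params.

Definition omega_val (r s : F) (i : nat) : nat -> F :=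
  if i == n then om_last n r s else if i == 0%N then om_zero n r s else om_mid n r s i.

Lemma mx_omegaE r s i : (i <= n)%N -> mx_omega n r s i = diag n (omega_val r s i).
Proof.
move=> i_le; rewrite /omega_val; have [->|iN] := eqVneq i n; first exact: omega_last.
rewrite /mx_omega (negbTE iN); have [->|i0] := eqVneq i 0%N; first exact: omega_zero.
by rewrite omega_mid //; lia.
Qed.

Lemma omega_val_prime r s i j : r != 0 -> s != 0 -> (i <= n)%N -> in_range j ->
  omega_val r s i j * omega_val r s i j^' = 1.
Proof.
move=> r0 s0 i_le j_in; rewrite /omega_val.
have side : r != 0 /\ s != 0 by [].
case: ifP => iN; [rewrite /om_last | case: ifP => i0; [rewrite /om_zero | rewrite /om_mid]];
  cases_if; field; by rewrite ?r0 ?s0.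
Qed.

Section Roots.
Variables (r s sr ss srs : F).
Hypotheses (sr0 : sr != 0) (ss0 : ss != 0).
Hypotheses (rE : r = sr ^+ 2) (sE : s = ss ^+ 2).
Let r_neq0 : r != 0. Proof. exact: sqrt_neq0 sr0 rE. Qed.
Let s_neq0 : s != 0. Proof. exact: sqrt_neq0 ss0 sE. Qed.

Lemma mx_f_sym z i : mx_f n r s sr ss srs z i = (mx_e n s r ss sr srs z^-1 i)^T.
Proof.
have trE j k : (E j k)^T = E k j by apply/matrixP => a b; rewrite !mxE andbC.
have trZ (c : F) m (A : 'M[F]_m) : (c *: A)^T = c *: A^T by apply/matrixP => a b; rewrite !mxE.
have trB m (A B : 'M[F]_m) : (A - B)^T = A^T - B^T by apply/matrixP => a b; rewrite !mxE.
rewrite /mx_f /mx_e; case: ifP => _; last case: ifP => _; rewrite !(trZ, trB, trE) //.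
- by rewrite [s * r]mulrC [sr ^- 3 * _]mulrC.
- by rewrite [ss * sr]mulrC.
- by rewrite [s * r]mulrC.
Qed.

Lemma tensZl c (A B : 'M[F]_N) : (c *: A) *t B = c *: (A *t B).
Proof. by apply/matrixP => k l; rewrite !mxE mulrA. Qed.

Lemma tensZr c (A B : 'M[F]_N) : A *t (c *: B) = c *: (A *t B).
Proof. by apply/matrixP => k l; rewrite !mxE mulrCA. Qed.

(** A uniform description of all nodes. The prefactor [k] absorbs the square root of r + s at i = n
    and the spectral parameter at i = 0; [t] is the factor it gains from w to z = u w. *)
Lemma mx_e_root i : (i <= n)%N -> exists p q c1 c2 (k : F -> F),
  [/\ in_range p, in_range q,
      forall z, mx_e n r s sr ss srs z i = k z *: root_mx n p q c1 c2,
      [/\ p <> p^'%N, p <> q & p <> q^'%N] &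
      forall u, u != 0 -> rden1 r s u != 0 -> rden2 n r s u != 0 ->
        exists2 t, ice_local n (al_coef n r s u) (be_coef r s u)
                     (Z_coef n r s sr ss u) (omega_val r s i) p q c1 c2 t &
          forall w, k (u * w) = t * k w].
Proof.
move=> i_le; rewrite /omega_val /mx_e /root_mx.
have [->|iN] := eqVneq i n.
  exists n, n.+1, (sr * ss)^-1, (- r^-1), (fun=> srs).
  split; [nlia | nlia | move=> z | split; nlia |].
    rewrite ifF; last by lia.
    by rewrite scaleNr (_ : n.+1^' = n.+1)%N //; nlia.
  by move=> u u0 d1 d2; exists 1; [exact: last_local | move=> w; rewrite mul1r].
have [_|i0] := eqVneq i 0%N.
  exists (1^')%N, 2%N, 1, (- (r * s)), (fun z => - (sr ^- 1 * ss ^- 3 * z)).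
  split; [nlia | nlia | move=> z | split; nlia |].
    rewrite (_ : 1^'^' = 1)%N; last by nlia.
    by congr (_ *: _); rewrite scale1r scaleNr.
  by move=> u u0 d1 d2; exists u; [exact: zero_local | move=> w; ring].
have i_in : (0 < i < n)%N by lia.
exists i, i.+1, 1, (- (r * s)^-1), (fun=> 1).
split; [nlia | nlia | move=> z | split; nlia |].
  by rewrite !scale1r scaleNr.
by move=> u u0 d1 d2; exists 1; [exact: mid_local | move=> w; rewrite mul1r].
Qed.

Lemma R_hat_e u i z w : (i <= n)%N -> u != 0 -> rden1 r s u != 0 -> rden2 n r s u != 0 ->
  z = u * w ->
  R_hat n r s sr ss u *m (mx_e n r s sr ss srs z i *t 1%:M
                          + mx_omega n r s i *t mx_e n r s sr ss srs w i) =
  (1%:M *t mx_e n r s sr ss srs w i + mx_e n r s sr ss srs z i *t mx_omega n r s i)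
  *m R_hat n r s sr ss u.
Proof.
move=> i_le u0 d1 d2 zE.
have [p [q [c1 [c2 [k [p_in q_in eE [pp pq pq'] loc]]]]]] := mx_e_root i_le.
have [t lt kt] := loc u u0 d1 d2.
rewrite mx_omegaE // !eE zE kt [t * _]mulrC -scalerA !tensZl !tensZr -!scalerDr.
by rewrite -scalemxAr -scalemxAl R_hat_root.
Qed.

Lemma R_hat_omega u i : (i <= n)%N ->
  let W := mx_omega n r s i *t mx_omega n r s i in
  R_hat n r s sr ss u *m W = W *m R_hat n r s sr ss u.
Proof.
by move=> i_le W; rewrite /W mx_omegaE // R_hat_diag // => j; exact: omega_val_prime.
Qed.
End Roots.

Section Intertwine.
Variables (r s sr ss srs : F).
Hypotheses (sr0 : sr != 0) (ss0 : ss != 0).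
Hypotheses (rE : r = sr ^+ 2) (sE : s = ss ^+ 2).

Variables (u z w : F) (i : nat).
Hypotheses (i_le : (i <= n)%N) (u0 : u != 0) (zE : z = u * w).
Hypotheses (d1_neq0 : rden1 r s u != 0) (d2_neq0 : rden2 n r s u != 0).
Local Notation Rh := (R_hat n r s sr ss u).
Local Notation e x := (mx_e n r s sr ss srs x i).
Local Notation f x := (mx_f n r s sr ss srs x i).
Local Notation om := (mx_omega n r s i).
Local Notation omp := (mx_omegap n r s i).

(** The transpose of [R_hat_e] for s, r and the inverses of u, z, w. Transposition reverses the
    products and so exchanges the two sides of the relation. *)
Lemma R_hat_f : Rh *m (1%:M *t f w + f z *t omp) = (f z *t 1%:M + omp *t f w) *m Rh.
Proof.
have z'E : z^-1 = u^-1 * w^-1 by rewrite zE invfM.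
have d1' := rden1_sym_neq0 u0 d1_neq0.
have d2' := rden2_sym_neq0 sr0 ss0 u0 rE sE d2_neq0.
have u'0 : u^-1 != 0 by rewrite invr_eq0.
have := R_hat_e srs ss0 sr0 sE rE i_le u'0 d1' d2' z'E.
move/(congr1 trmx); rewrite !trmx_mul (R_hat_sym n_ge3 sr0 ss0 u0 rE sE d1_neq0 d2_neq0).
have omT : (mx_omega n s r i)^T = omp.
  rewrite mx_omegap_sym mx_omegaE //; apply/matrixP => a b; rewrite !mxE eq_sym.
  by case: eqP => [->|]; rewrite ?mul0r.
have trD m (A B : 'M[F]_m) : (A + B)^T = A^T + B^T by apply/matrixP => a b; rewrite !mxE.
by rewrite !trD !trmx_tens trmx1 omT !mx_f_sym => <-.
Qed.

Lemma R_hat_omegap : Rh *m (omp *t omp) = (omp *t omp) *m Rh.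
Proof.
have := R_hat_omega ss0 sr0 sE rE u^-1 i_le.
move/(congr1 trmx); rewrite !trmx_mul (R_hat_sym n_ge3 sr0 ss0 u0 rE sE d1_neq0 d2_neq0).
have omT : (mx_omega n s r i)^T = omp.
  rewrite mx_omegap_sym mx_omegaE //; apply/matrixP => a b; rewrite !mxE eq_sym.
  by case: eqP => [->|]; rewrite ?mul0r.
by rewrite trmx_tens omT => <-.
Qed.
End Intertwine.
End Generators.

(** * Generators acting on functions of the spectral parameters *)

Section Loops.
Variables (C : fieldType) (n : nat).
Local Notation N := (dimV n).

Lemma val_dilate (c : C) (z : nonzero C) : c != 0 -> val (dilate c z) = c * val z.
Proof. by move=> c0; rewrite /dilate insubdK // unfold_in mulf_neq0 ?(valP z). Qed.

Lemma on_leftE (a : loop C n -> loop C n) A sg :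
  (forall phi z, a phi z = A z *m phi (sg z)) ->
  forall phi z w, on_left a phi z w = (A z *t 1%:M) *m phi (sg z) w.
Proof.
move=> aE phi z w; apply/colP => k; rewrite mxE aE.
case: (mxtens_indexP k) => i j; rewrite mul_tensl mxtens_indexK mxE /=.
by apply: eq_bigr => i' _; rewrite mxE sum_1l.
Qed.

Lemma on_rightE (a : loop C n -> loop C n) A sg :
  (forall phi z, a phi z = A z *m phi (sg z)) ->
  forall phi z w, on_right a phi z w = (1%:M *t A w) *m phi z (sg w).
Proof.
move=> aE phi z w; apply/colP => k; rewrite mxE aE.
case: (mxtens_indexP k) => i j; rewrite mul_tensl mxtens_indexK sum_1l mxE /=.
by apply: eq_bigr => i' _; rewrite mxE.
Qed.

Variables (r s sr ss srs : C).

(** A generator acts by this matrix composed with the substitution [gen_shift], which moves z only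
    for D, D' and their inverses. *)
Definition gen_mx (x : generator n) (z : C) : 'M[C]_N :=
  match x with
  | gen_e i => mx_e n r s sr ss srs z i
  | gen_f i => mx_f n r s sr ss srs z i
  | gen_w i => mx_omega n r s i
  | gen_wV i => invmx (mx_omega n r s i)
  | gen_wp i => mx_omegap n r s i
  | gen_wpV i => invmx (mx_omegap n r s i)
  | _ => 1%:M
  end.

Definition gen_shift (x : generator n) (z : nonzero C) : nonzero C :=
  match x with
  | gen_D => dilate (r_ n r 0) z
  | gen_DV => dilate (r_ n r 0)^-1 z
  | gen_Dp => dilate (s_ n s 0) z
  | gen_DpV => dilate (s_ n s 0)^-1 z
  | _ => z
  end.

Lemma T_genE x phi z :
  T_gen r s sr ss srs x phi z = gen_mx x (val z) *m phi (gen_shift x z).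
Proof. by case: x => *; rewrite /= ?mul1mx. Qed.

Definition coproduct_mx (x : generator n) (z w : C) : 'M[C]_(N * N) :=
  match x with
  | gen_e i => mx_e n r s sr ss srs z i *t 1%:M
               + mx_omega n r s i *t mx_e n r s sr ss srs w i
  | gen_f i => 1%:M *t mx_f n r s sr ss srs w i
               + mx_f n r s sr ss srs z i *t mx_omegap n r s i
  | _ => gen_mx x z *t gen_mx x w
  end.

Hypotheses (n_ge3 : (3 <= n)%N) (sr0 : sr != 0) (ss0 : ss != 0).
Hypotheses (rE : r = sr ^+ 2) (sE : s = ss ^+ 2).

Lemma gen_shift_ratio x z w :
  val (gen_shift x z) / val (gen_shift x w) = val z / val w.
Proof.
have r2 : r_ n r 0 != 0 by rewrite /r_; case: ifP; rewrite ?expf_neq0 ?(sqrt_neq0 sr0 rE).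
have s2 : s_ n s 0 != 0 by rewrite /s_; case: ifP; rewrite ?expf_neq0 ?(sqrt_neq0 ss0 sE).
by case: x => * //=; rewrite !val_dilate ?invr_eq0 // -mulf_div divff ?invr_eq0 // mul1r.
Qed.

Lemma tens_unit_comm (M : 'M[C]_(N * N)) (A : 'M[C]_N) :
  M *m (A *t A) = (A *t A) *m M ->
  M *m (invmx A *t invmx A) = (invmx A *t invmx A) *m M.
Proof.
(* For a matrix that is not invertible, [invmx A] is A by convention and the goal is the
   hypothesis. *)
have [uA|] := boolP (A \in unitmx); last by move=> uA; rewrite /invmx (negbTE uA).
have K : (A *t A) *m (invmx A *t invmx A) = 1%:M.
  rewrite tensmx_mul mulmxV //; apply/matrixP => k l.
  case: (mxtens_indexP k) => i j; case: (mxtens_indexP l) => i' j'.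
  by rewrite tensmxE !mxE -natrM mulnb (can_eq (@mxtens_indexK _ _)) xpair_eqE.
have K' := mulmx1C K.
move=> MA; rewrite -[LHS]mul1mx -{1}K' -!mulmxA; congr (_ *m _).
by rewrite !mulmxA -MA -mulmxA K mulmx1.
Qed.

(** The matrix [R_hat] carries the coproduct to the opposite one; the flip then restores the order
    of the factors and leaves z and w exchanged. *)
Lemma R_mx_coproduct x (z w : nonzero C) : not_pole n r s (val z / val w) ->
  R_mx n r s sr ss (val z / val w) *m coproduct_mx x (val z) (val w) =
  coproduct_mx x (val w) (val z) *m R_mx n r s sr ss (val z / val w).
Proof.
move=> [d1 d2]; have z0 : val z != 0 := valP z; have w0 : val w != 0 := valP w.
set u := val z / val w in d1 d2 *.
have u0 : u != 0 by rewrite mulf_neq0 ?invr_eq0.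
have zE : val z = u * val w by rewrite /u divfK.
have grouplike (A : 'M[C]_N) :
    R_hat n r s sr ss u *m (A *t A) = (A *t A) *m R_hat n r s sr ss u ->
    R_mx n r s sr ss u *m (A *t A) = (A *t A) *m R_mx n r s sr ss u.
  by move=> RA; rewrite /R_mx -mulmxA RA mulmxA flip_tens mulmxA.
have one : R_mx n r s sr ss u *m (1%:M *t 1%:M) = (1%:M *t 1%:M) *m R_mx n r s sr ss u.
  have -> : (1%:M *t 1%:M : 'M[C]_(N * N)) = 1%:M.
    apply/matrixP => k l.
    case: (mxtens_indexP k) => i j; case: (mxtens_indexP l) => i' j'.
    by rewrite tensmxE !mxE -natrM mulnb (can_eq (@mxtens_indexK _ _)) xpair_eqE.
  by rewrite mulmx1 mul1mx.
have i_le (i : 'I_n.+1) : (i <= n)%N by rewrite -ltnS.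
case: x => [i|i|i|i|i|i||||||||]; rewrite /coproduct_mx /gen_mx //.
- have := R_hat_e n_ge3 srs sr0 ss0 rE sE (i_le i) u0 d1 d2 zE.
  rewrite /R_mx; move: (R_hat n r s sr ss u) => M ME; rewrite -mulmxA {}ME.
  by rewrite [LHS]mulmxA [RHS]mulmxA mulmxDr !flip_tens -mulmxDl.
- have := R_hat_f n_ge3 srs sr0 ss0 rE sE (i_le i) u0 zE d1 d2.
  rewrite /R_mx; move: (R_hat n r s sr ss u) => M ME; rewrite -mulmxA {}ME.
  by rewrite [LHS]mulmxA [RHS]mulmxA mulmxDr !flip_tens -mulmxDl.
- exact/grouplike/(R_hat_omega n_ge3 sr0 ss0 rE sE).
- exact/tens_unit_comm/grouplike/(R_hat_omega n_ge3 sr0 ss0 rE sE).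
- exact/grouplike/(R_hat_omegap n_ge3 sr0 ss0 rE sE).
- exact/tens_unit_comm/grouplike/(R_hat_omegap n_ge3 sr0 ss0 rE sE).
Qed.
End Loops.

(** * Algebraically independent elements are nonzero *)

(** Stated for mere functions: in a field of unspecified characteristic [ratr] need not be a ring
    morphism. *)
Lemma map_polyX_id (A B : nzRingType) (f : A -> B) :
  f 0 = 0 -> f 1 = 1 -> map_poly f 'X = 'X.
Proof. by move=> f0 f1; apply/polyP => i; rewrite coef_map_id0 // !coefX; case: eqP. Qed.

Lemma map_polyC_id (A B : nzRingType) (f : A -> B) (c : A) :
  f 0 = 0 -> map_poly f c%:P = (f c)%:P.
Proof. by move=> f0; apply/polyP => i; rewrite coef_map_id0 // !coefC; case: eqP. Qed.

(** The outer and the inner variable, as polynomials, evaluate to x and y. *)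
Lemma alg_independent_neq0 (K : fieldType) (x y : K) :
  alg_independent x y -> x != 0 /\ y != 0.
Proof.
move=> ind.
have q0 : ratr 0 = 0 :> K by rewrite /ratr (_ : numq 0 = 0) ?mul0r.
have q1 : ratr 1 = 1 :> K.
  by have [e1 e2] := (numq_int 1, denq_int 1); rewrite /ratr -rat1 e1 e2 divr1.
have m0 : map_poly (ratr : rat -> K) 0 = 0 by rewrite map_poly0.
have m1 : map_poly (ratr : rat -> K) 1 = 1 by rewrite -!polyC1 map_polyC_id // q1.
have : ('X%:P : {poly {poly rat}}) != 0 by rewrite polyC_eq0 polyX_eq0.
have : ('X : {poly {poly rat}}) != 0 by rewrite polyX_eq0.
move=> /ind h1 /ind; move: h1.
rewrite (map_polyX_id m0 m1) hornerX hornerC => h1.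
by rewrite (map_polyC_id _ m0) (map_polyX_id q0 q1) hornerC hornerX => h2.
Qed.

(** * From generators to the whole algebra *)

Section Intertwiner.
Variables (K C : fieldType) (iota : {rmorphism K -> C}) (n : nat).
Variables (r s sr ss srs : K).
Hypotheses (n_ge3 : (3 <= n)%N) (r_neq0 : r != 0) (s_neq0 : s != 0).
Hypotheses (sr_sqr : sr ^+ 2 = r) (ss_sqr : ss ^+ 2 = s).
Variables (Delta : U_affine n r s -> U_affine2 n r s).
Hypothesis Delta_coproduct : is_coproduct Delta.
Variable T : U_affine n r s -> loop C n -> loop C n.
Hypothesis T_rep : is_vector_rep iota sr ss srs T.
Variable TT : U_affine2 n r s -> loop2 C n -> loop2 C n.
Hypothesis TT_tensor : is_tensor_rep iota T TT.

Local Notation N := (dimV n).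
Local Notation gmx := (gen_mx (iota r) (iota s) (iota sr) (iota ss) (iota srs)).
Local Notation gsh := (gen_shift (iota r) (iota s)).
Local Notation cmx := (coproduct_mx (iota r) (iota s) (iota sr) (iota ss) (iota srs)).
Local Notation ok z w := (not_pole n (iota r) (iota s) (val z / val w)).

Let T_gen_local x phi z : T (ugen r s x) phi z = gmx x (val z) *m phi (gsh x z).
Proof. by rewrite (proj2 T_rep) T_genE. Qed.

Let T_one phi z : T 1 phi z = 1%:M *m phi z.
Proof. by have [[_ T1 _ _ _] _] := T_rep; rewrite T1 mul1mx. Qed.

Let TT_pure x y A B sg sh : (forall phi z, T x phi z = A z *m phi (sg z)) ->
    (forall phi z, T y phi z = B z *m phi (sh z)) ->
  forall Phi z w, TT (x ⊗ y) Phi z w = (A z *t B w) *m Phi (sg z) (sh w).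
Proof.
move=> xE yE Phi z w; rewrite (proj2 TT_tensor) (on_leftE xE) (on_rightE yE).
by rewrite mulmxA tensmx_mul mul1mx mulmx1.
Qed.

Lemma TT_Delta_gen x Phi z w :
  TT (Delta (ugen r s x)) Phi z w = cmx x (val z) (val w) *m Phi (gsh x z) (gsh x w).
Proof.
have TTD a b v : TT (a + b) v = TT a v + TT b v by have [[]] := TT_tensor.
have addE (u v : loop2 C n) z' w' : (u + v) z' w' = u z' w' + v z' w' by [].
have gen := TT_pure (T_gen_local x) (T_gen_local x).
rewrite (proj2 Delta_coproduct); case: x gen => [i|i|i|i|i|i||||||||] gen;
  rewrite /coproduct_gen; try exact: gen.
- rewrite TTD addE (TT_pure (T_gen_local (gen_e i)) T_one).
  by rewrite (TT_pure (T_gen_local (gen_w i)) (T_gen_local (gen_e i))) -mulmxDl.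
- rewrite TTD addE (TT_pure T_one (T_gen_local (gen_f i))).
  by rewrite (TT_pure (T_gen_local (gen_f i)) (T_gen_local (gen_wp i))) -mulmxDl.
Qed.

Local Notation Rop := (R_op (iota r) (iota s) (iota sr) (iota ss)).

(** The values of X Phi at regular points depend only on those of Phi at regular points. This is
    what lets a relation that holds only away from the poles be substituted under another
    operator. *)
Definition pole_free_local (X : loop2 C n -> loop2 C n) : Prop :=
  forall Phi Psi, (forall z w, ok z w -> Phi w z = Psi w z) ->
  forall z w, ok z w -> X Phi w z = X Psi w z.

(** Induction on a term representing x; locality is proved along with the relation because the
    product case needs it. *)
Lemma intertwine_all x :
  pole_free_local (TT (Delta x)) /\
  forall Phi z w, ok z w -> Rop (TT (Delta x) Phi) w z = TT (Delta x) (Rop Phi) w z.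
Proof.
have [[TTlin TT1 TTM TTD TTZ] _] := TT_tensor.
have [[Dlin D1 DM] _] := Delta_coproduct.
have D0 : Delta 0 = 0.
  have := Dlin 1 0 0; rewrite !scale1r addr0 => h.
  by apply: (@addrI _ (Delta 0)); rewrite addr0 -h.
have DD a b : Delta (a + b) = Delta a + Delta b.
  by have := Dlin 1 a b; rewrite !scale1r.
have DZ k a : Delta (k *: a) = k *: Delta a.
  by have := Dlin k a 0; rewrite D0 !addr0.
have sr0 : iota sr != 0 by rewrite fmorph_eq0; apply: contra_neq r_neq0; rewrite -sr_sqr => ->; rewrite expr0n.
have ss0 : iota ss != 0 by rewrite fmorph_eq0; apply: contra_neq s_neq0; rewrite -ss_sqr => ->; rewrite expr0n.
have rE : iota r = iota sr ^+ 2 by rewrite -rmorphXn sr_sqr.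
have sE : iota s = iota ss ^+ 2 by rewrite -rmorphXn ss_sqr.
have ratio (g : generator n) (z w : nonzero C) : ok z w -> ok (gsh g z) (gsh g w).
  by rewrite (gen_shift_ratio sr0 ss0 rE sE g).
have addE (u v : loop2 C n) z' w' : (u + v) z' w' = u z' w' + v z' w' by [].
have sclE k (v : loop2 C n) z' w' : (k *: v) z' w' = k *: v z' w' by [].
elim/classW: x; elim=> [g|k|a IHa b IHb|a IHa b IHb].
- split=> [Phi Psi PP z w zw|Phi z w zw]; rewrite !TT_Delta_gen; first by rewrite PP //; apply: ratio.
  rewrite /R_op (gen_shift_ratio sr0 ss0 rE sE g) TT_Delta_gen !mulmxA.
  by rewrite (R_mx_coproduct _ n_ge3 sr0 ss0 rE sE _ zw) /R_mx !mulmxA.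
(* A scalar is a multiple of the unit, on which [Delta] and [TT] are known. *)
- have -> : class (@affine_rel K n r s) (Scal k) =
      k *: class (@affine_rel K n r s) (Scal 1).
    by rewrite -classZ; apply/eq_class/cong_sym/cong_mul1r.
  rewrite class1 DZ D1; split=> [Phi Psi PP z w zw|Phi z w zw]; rewrite !TTZ !TT1; first by rewrite !sclE PP.
  by rewrite /R_op !sclE -scalemxAr.
- rewrite classD DD; have [[la ia] [lb ib]] := (IHa, IHb).
  split=> [Phi Psi PP z w zw|Phi z w zw]; rewrite !TTD !addE; first by rewrite (la _ _ PP) // (lb _ _ PP).
  by rewrite -ia // -ib // /R_op addE mulmxDr.
- rewrite classM DM; have [[la ia] [lb ib]] := (IHa, IHb).
  split=> [Phi Psi PP z w zw|Phi z w zw]; rewrite !TTM.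
    by apply: la => // z' w' ?; apply: lb.
  (* R moves past the left factor by [ia]; moving it past the right one by [ib] is valid at regular
     points only, which suffices by the locality [la]. *)
  by rewrite ia //; apply: la => // z' w' ?; apply: ib.
Qed.
End Intertwiner.

Theorem proposition4p14 (R : realType) (K : fieldType)
  (iota : {rmorphism K -> R[i]}) (n : nat) (n_ge3 : (3 <= n)%N)
  (r s sr ss srs : K) (rs_indep : alg_independent r s)
  (sr_sqr : sr ^+ 2 = r) (ss_sqr : ss ^+ 2 = s) (srs_sqr : srs ^+ 2 = r + s)
  (Delta : U_affine n r s -> U_affine2 n r s)
  (Delta_coproduct : is_coproduct Delta)
  (T : U_affine n r s -> loop R[i] n -> loop R[i] n)
  (T_rep : is_vector_rep iota sr ss srs T)
  (TT : U_affine2 n r s -> loop2 R[i] n -> loop2 R[i] n)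
  (TT_tensor : is_tensor_rep iota T TT)
  (x : U_affine n r s) (phi : loop2 R[i] n) (z w : nonzero R[i])
  (zw_not_pole : not_pole n (iota r) (iota s) (val z / val w)) :
  R_op (iota r) (iota s) (iota sr) (iota ss) (TT (Delta x) phi) w z =
  TT (Delta x) (R_op (iota r) (iota s) (iota sr) (iota ss) phi) w z.
Proof.
have [r_neq0 s_neq0] := alg_independent_neq0 rs_indep.
by have [_] := intertwine_all n_ge3 r_neq0 s_neq0 sr_sqr ss_sqr Delta_coproduct T_rep TT_tensor x; apply.
Qed.
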